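(* Let $\{\alpha_n\}_{n\ge1}$ be a sequence defining a convex set $K\subset\mathbb{R}^2$ as described in the context, and let $x:[-1,1]\to\mathbb{R}$ be the function whose graph, i.e. the set $\{(x(y),y) : y\in[-1,1]\}$, is the intersection of the boundary $\partial K$ with the half plane $\{(x,y)\in\mathbb{R}^2 : x\ge 0\}$. Then $x(\cdot)$ is continuously differentiable on $[-1,1]$ (with one-sided derivatives at the endpoints). Moreover: (i) if $\alpha_n=Cn^{-q}$ for all $n$ with $C,q>0$ (Case A), or $\alpha_n=C\lambda^n$ for all $n$ with $C>0$, $\lambda\in(0,1)$ (Case B), then the derivative $x'$ is Lipschitz on $[-1,1]$; (ii) if $\alpha_n=C\lambda^{n^2}$ for all $n$ with $C>0$, $\lambda\in(0,1/2)$ (Case C), then $x'$ is not locally Lipschitz around $0$, i.e. $x'$ is not Lipschitz on any neighborhood of $0$.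
   Context: Identify $\mathbb{R}^2$ (Euclidean norm $\|\cdot\|$) with $\mathbb{C}$. A sequence defining $K$ is a strictly decreasing sequence $\{\alpha_n\}_{n\ge1}\subset(0,\pi/2]$ with $\alpha_1=\pi/2$, $\lim_{n\to\infty}\alpha_n=0$, and $\alpha_{n+1}\le\frac{\alpha_n+\alpha_{n+2}}{2}$ for all $n\ge 1$. (In Cases A, B, C the constant $C$ is thus the one for which $\alpha_1=\pi/2$.) Construction of $K$: put $A_n=e^{i\alpha_n}$. For $n\ge1$ let $T_n$ be the midpoint of the segment $A_nA_{n+1}$. For $n\ge2$ let $S_n$ be the point of the segment $A_{n-1}A_n$ with $\|A_n-S_n\|=\|A_n-T_n\|=\sin\left(\frac{\alpha_n-\alpha_{n+1}}{2}\right)$. For $n\ge 2$ let $C_n$ be the circular arc with endpoints $S_n$ and $T_n$, contained in the triangle $S_nA_nT_n$, tangent to the segment $A_nS_n$ at $S_n$ and to the segment $T_nA_n$ at $T_n$ (it replaces these two segments). Let $J_1$ be the convex hull of the points $0$ and $1$, the arcs $C_n$ ($n\ge2$), and the line segments connecting them, namely the segment $A_1S_2$ (with $A_1=i$) and the segments $T_nS_{n+1}$ ($n\ge2$). Let $J_2$ be the reflection of $J_1$ in the real axis, let $J_3$ be the reflection of $J_1\cup J_2$ in the imaginary axis, and set $K=J_1\cup J_2\cup J_3$. *)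

(* Defs.v *)
From mathcomp Require Import all_boot all_order all_algebra.
From mathcomp Require Import all_classical all_reals all_analysis.

Set Implicit Arguments.
Unset Strict Implicit.
Unset Printing Implicit Defensive.

Import Order.TTheory GRing.Theory Num.Theory.
Import numFieldNormedType.Exports.

Local Open Scope classical_set_scope.
Local Open Scope ring_scope.

(* The library norm of the product [R^o * R^o] is the sup norm, so only its
   vector space structure and its topology are used; Euclidean lengths and
   angles go through [dotp]. *)
Notation plane R := (R^o * R^o)%type.

Section Plane.
Variable R : realType.
Implicit Types (p q O S A T : plane R) (X E : set (plane R)).

Definition dotp p q : R := p.1 * q.1 + p.2 * q.2.

Definition enorm p : R := Num.sqrt (dotp p p).

(* e^(it) *)
Definition cis (t : R) : plane R := (cos t, sin t).

Definition segment p q : set (plane R) :=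
  [set (1 - t) *: p + t *: q | t in `[0, 1]].

Definition convex_hull X : set (plane R) :=
  smallest (@convex_set R (plane R)) X.

Definition boundary X : set (plane R) := closure X `\` interior X.

Definition reflect_real p : plane R := (p.1, - p.2).

Definition reflect_imag p : plane R := (- p.1, p.2).

(* The circular arcs with endpoints [S] and [T] that lie in the triangle [SAT]
   and are tangent at [S] and [T] to its sides [AS] and [TA]: tangency is
   orthogonality of the side to the radius. *)
Definition tangent_arcs S A T : set (set (plane R)) :=
  [set E | exists O (r a b : R),
    [/\ 0 < r /\ a < b < a + 2 * pi,
        E = [set O + r *: cis t | t in `[a, b]],
        [set O + r *: cis a; O + r *: cis b] = [set S; T],
        E `<=` convex_hull [set S; A; T] &
        dotp (S - O) (A - S) = 0 /\ dotp (T - O) (A - T) = 0]].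

End Plane.

Section Construction.
Variable R : realType.

(* Sequences are indexed from 1: [alpha 0] is never constrained nor used. *)
Variable alpha : nat -> R.

Definition defining_sequence : Prop :=
  [/\ alpha 1%N = pi / 2,
      forall n, (1 <= n)%N -> 0 < alpha n <= pi / 2,
      forall n, (1 <= n)%N -> alpha n.+1 < alpha n,
      alpha n @[n --> \oo] --> 0 &
      forall n, (1 <= n)%N -> alpha n.+1 <= (alpha n + alpha n.+2) / 2].

Definition ptA (n : nat) : plane R := cis (alpha n).

Definition ptT (n : nat) : plane R := 2^-1 *: (ptA n + ptA n.+1).

(* [ptS] and [arcC] are definite descriptions: [get] selects the unique element
   of its argument. *)
Definition ptS (n : nat) : plane R :=
  get [set p | segment (ptA n.-1) (ptA n) p /\
               enorm (ptA n - p) = enorm (ptA n - ptT n)].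

Definition arcC (n : nat) : set (plane R) :=
  get (tangent_arcs (ptS n) (ptA n) (ptT n)).

Definition J1 : set (plane R) :=
  convex_hull ([set (0, 0); (1, 0)]
    `|` \bigcup_(n in [set n | (2 <= n)%N]) arcC n
    `|` segment (ptA 1) (ptS 2)
    `|` \bigcup_(n in [set n | (2 <= n)%N]) segment (ptT n) (ptS n.+1)).

Definition J2 : set (plane R) := [set reflect_real p | p in J1].

Definition J3 : set (plane R) := [set reflect_imag p | p in J1 `|` J2].

Definition bodyK : set (plane R) := J1 `|` J2 `|` J3.

Definition caseA : Prop :=
  exists C q : R, [/\ 0 < C, 0 < q &
    forall n, (1 <= n)%N -> alpha n = C * powR n%:R (- q)].

Definition caseB : Prop :=
  exists C lambda : R, [/\ 0 < C, 0 < lambda < 1 &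
    forall n, (1 <= n)%N -> alpha n = C * lambda ^+ n].

Definition caseC : Prop :=
  exists C lambda : R, [/\ 0 < C, 0 < lambda < 2^-1 &
    forall n, (1 <= n)%N -> alpha n = C * lambda ^+ (n ^ 2)].

End Construction.

(* [df] is the derivative of [f] relative to [D]: two-sided in the interior of
   an interval [D], one-sided at its endpoints. *)
Definition is_derivative_on (R : realType) (D : set R) (f df : R -> R) : Prop :=
  forall y, D y -> (f z - f y) / (z - y) @[z --> within D y^'] --> df y.

(* Main.v *)
Require Import Defs.
From mathcomp Require Import all_boot all_order all_algebra.
From mathcomp Require Import all_classical all_reals all_analysis.
From mathcomp Require Import ring lra zify.

(** On the side [A_n A_(n+1)] the outward normal of [K] has angle
    [beta n = (alpha n + alpha n.+1) / 2], and along the arc at [A_(n+1)] it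
    turns from [beta n] down to [beta n.+1].  The support line of [K] with normal
    angle [phi] touches [K] at the points of the profile with that normal, so
    [- tan phi] is a supergradient of [x] there; a function with a continuous
    choice of supergradients is differentiable with that derivative.  Along an
    arc of radius [r] the height is [const + r * sin phi], so [sin phi] is
    [1 / r]-Lipschitz in the height.  Hence [x'] is Lipschitz as soon as the radii
    are bounded below, i.e. as soon as the ratios
    [(alpha n - alpha n.+1) / (alpha n.+1 - alpha n.+2)] are bounded (Cases A and
    B); in Case C these ratios are unbounded, and so is the difference quotient
    of [x'] between the two ends of the [n]-th arc. *)

Import Order.TTheory GRing.Theory Num.Theory.
Import numFieldNormedType.Exports.

Local Open Scope classical_set_scope.
Local Open Scope ring_scope.

Set Implicit Arguments.
Unset Strict Implicit.
Unset Printing Implicit Defensive.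

(** * Trigonometry and convex hulls in the plane *)

Section Trigonometry.
Variable R : realType.
Implicit Types a b t x y : R.

(** The profile [x] is known only through [hx], so it is reached through two facts: a point of
    [bodyK] that maximises a nonzero linear form over [bodyK] is a boundary point, and a closed
    half-plane containing [bodyK] contains its closure. The points S_n and the arcs are values of
    [get], so each specification must be shown to be satisfiable, and then to determine its object
    as far as it is used.

    The arc at A_(n+1) replaces legs of length [sin (delta n.+1)] and turns by
    [delta n + delta n.+1]. Its radius is thus about [2 * delta n.+1 / (delta n + delta n.+1)],
    which is how the ratios of the overview enter. The pieces accumulate at height 0 and none
    contains it: there the supergradient comes from the vertical support line at (1, 0), and
    continuity from [beta n] tending to 0. *)

Lemma ler_cos0pi x y : 0 <= x -> x <= y -> y <= pi -> cos y <= cos x.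
Proof.
move=> x0 xy ypi; move: (xy); rewrite le_eqVlt => /predU1P[->//|xy'].
by rewrite ltW// ltr_cos// in_itv/= ?x0 ?ypi ?andbT ?(le_trans xy)// (le_trans x0).
Qed.

Lemma ler_cos_norm x y : `|x| <= y -> y <= pi -> cos y <= cos x.
Proof. by move=> xy ypi; rewrite -(cos_norm x) ler_cos0pi. Qed.

Lemma ler_sin_pihalf x y :
  - (pi / 2) <= x -> x <= y -> y <= pi / 2 -> sin x <= sin y.
Proof.
move=> x0 xy ypi; move: (xy); rewrite le_eqVlt => /predU1P[->//|xy'].
rewrite ltW// ltr_sin// in_itv/= ?x0 ?ypi ?andbT ?(le_trans xy)//.
by rewrite (le_trans x0).
Qed.

(** [acos (cos (t - m))] is [t - m] up to sign and a multiple of 2 pi, and comparing sines decides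
    the sign. This normalises the parameter of an arc, whose interval in [tangent_arcs] is fixed
    only modulo 2 pi. *)
Lemma cis_reduce t m h : 0 <= h -> h <= pi -> cos h <= cos (t - m) ->
  exists2 u, m - h <= u <= m + h & cis u = cis t.
Proof.
move=> h0 hpi ht.
have ct1 : -1 <= cos (t - m) <= 1 by rewrite cos_geN1 cos_le1.
set w := acos (cos (t - m)).
have cw : cos w = cos (t - m) by rewrite acosK// in_itv.
have w0 : 0 <= w by rewrite acos_ge0.
have wpi : w <= pi by rewrite acos_lepi.
have wh : w <= h.
  rewrite leNgt; apply/negP => hw.
  have : cos w < cos h by rewrite ltr_cos// in_itv/= ?h0 ?hpi ?w0 ?wpi.
  by rewrite ltNge cw ht.
have cisE (u : R) : cos u = cos (t - m) -> sin u = sin (t - m) ->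
    cis (m + u) = cis t :> plane R.
  move=> cu su; rewrite /cis cosD sinD cu su -cosD -sinD.
  by rewrite (addrC m) subrK.
have : sin w ^+ 2 = sin (t - m) ^+ 2 by rewrite !sin2cos2 cw.
move/eqP; rewrite eqf_sqr => /orP[/eqP sw|/eqP sw].
  by exists (m + w); [apply/andP; split; lra|exact: cisE].
exists (m - w); first by apply/andP; split; lra.
by apply: cisE; rewrite ?cosN ?sinN// sw opprK.
Qed.

End Trigonometry.

Section PlaneGeometry.
Variable R : realType.
Implicit Types (p q e : plane R) (X : set (plane R)) (a b c t : R).

(** The complex number i e^(it): the upward direction of a side whose outward normal has angle [t]
    in (0, pi/2). *)
Definition icis t : plane R := (- sin t, cos t).

Lemma dotpDl p q e : dotp (p + q) e = dotp p e + dotp q e.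
Proof. by rewrite /dotp /=; ring. Qed.

Lemma dotpZl a p e : dotp (a *: p) e = a * dotp p e.
Proof. by rewrite /dotp /= /GRing.scale /=; ring. Qed.

Lemma dotpBl p q e : dotp (p - q) e = dotp p e - dotp q e.
Proof. by rewrite /dotp /=; ring. Qed.

Lemma dotp_cis a b : dotp (cis a) (cis b) = cos (b - a).
Proof. by rewrite /dotp /= cosB; ring. Qed.

Lemma dotp_icis a b : dotp (icis a) (cis b) = sin (b - a).
Proof. by rewrite /dotp /= sinB; ring. Qed.

Lemma plane_eqP p q : p.1 = q.1 -> p.2 = q.2 -> p = q.
Proof. by case: p q => [? ?] [? ?] /= -> ->. Qed.

Lemma segment_l p q : segment p q p.
Proof.
exists 0; first by rewrite /= in_itv/= lexx ler01.
by rewrite subr0 scale1r scale0r addr0.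
Qed.

Lemma segment_sym p q x : segment p q x -> segment q p x.
Proof.
move=> -[t]; rewrite /= in_itv/= => /andP[t0 t1] <-; exists (1 - t).
  by rewrite /= in_itv/= subr_ge0 t1 gerBl t0.
by rewrite subKr addrC.
Qed.

Lemma segment_r p q : segment p q q.
Proof. exact/segment_sym/segment_l. Qed.

Lemma segment_dotp p q x e c :
  segment p q x -> dotp p e <= c -> dotp q e <= c -> dotp x e <= c.
Proof.
move=> -[t]; rewrite /= in_itv/= => /andP[t0 t1] <- pc qc.
by rewrite dotpDl !dotpZl; nra.
Qed.

Lemma convex_halfplane e c :
  @convex_set R (plane R) [set p | dotp p e <= c].
Proof.
move=> x y k; rewrite !inE /= => xc yc.
rewrite /conv /= dotpDl !dotpZl.
have k0 : 0 <= k%:num by []; have k1 : k%:num <= 1 by [].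
by rewrite /unstable.onem; move: k%:num k0 k1 => t; nra.
Qed.

Lemma convex_hull_halfplane X e c :
  (forall p, X p -> dotp p e <= c) ->
  forall p, convex_hull X p -> dotp p e <= c.
Proof. by move=> Xc; apply: smallest_sub; [exact: convex_halfplane|]. Qed.

Lemma convex_hull_segment X p q : convex_hull X p -> convex_hull X q ->
  segment p q `<=` convex_hull X.
Proof.
move=> Xp Xq _ [t] /= + <-; rewrite in_itv/= => /andP[t0 t1].
move=> Y [cY XY].
have [Yp Yq] : Y p /\ Y q by split; [apply: Xp|apply: Xq].
have k0 : 0 <= 1 - t by rewrite subr_ge0.
have k1 : 1 - t <= 1 by rewrite gerBl.
have := cY p q (Itv01 k0 k1); rewrite !inE => /(_ Yp Yq).
by rewrite /conv /= /unstable.onem subKr.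
Qed.

End PlaneGeometry.

(** * Rounding off a corner *)

(* An isosceles corner at [A] with legs of length [l]; the outward normals of the
   legs [AS] and [AT] have angles [phi2] and [phi1]. *)
Section Corner.
Variable R : realType.
Variables (A : plane R) (l phi1 phi2 : R).
Hypotheses (l_gt0 : 0 < l) (phi12 : phi1 < phi2) (phi2_lt : phi2 < phi1 + pi).

Definition corner_mid : R := (phi1 + phi2) / 2.
Definition corner_half : R := (phi2 - phi1) / 2.
(** Half the interior angle at [A] is [pi / 2 - h]. Hence the circle tangent to both legs at
    distance [l] from [A] has radius [l * cot h], and its centre is on the bisector at distance
    [l / sin h]. *)
Definition corner_radius : R := l * cos corner_half / sin corner_half.
Definition corner_center : plane R := A - (l / sin corner_half) *: cis corner_mid.

Local Notation m := corner_mid.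
Local Notation h := corner_half.
Local Notation r := corner_radius.
Local Notation O := corner_center.
Local Notation S := (A + l *: icis phi2).
Local Notation T := (A - l *: icis phi1).

Let h_bounds : 0 < h < pi / 2.
Proof.
have := phi12; have := phi2_lt; rewrite /corner_half => *.
by apply/andP; split; lra.
Qed.

Lemma corner_sin_gt0 : 0 < sin h.
Proof. exact/sin_gt0_pihalf/h_bounds. Qed.

Lemma corner_cos_gt0 : 0 < cos h.
Proof.
by apply: cos_gt0_pihalf; have /andP[? ?] := h_bounds; apply/andP; split; lra.
Qed.

Lemma corner_radius_gt0 : 0 < r.
Proof. by rewrite divr_gt0 ?mulr_gt0 ?corner_sin_gt0 ?corner_cos_gt0. Qed.

Let phi1E : phi1 = m - h. Proof. by rewrite /m /h; field. Qed.
Let phi2E : phi2 = m + h. Proof. by rewrite /m /h; field. Qed.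

Lemma corner_S : O + r *: cis phi2 = S.
Proof.
have sh := lt0r_neq0 corner_sin_gt0.
have mE : m = phi2 - h by rewrite phi2E addrK.
by apply: plane_eqP; rewrite /O /r /= /GRing.scale /= mE ?cosB ?sinB; field.
Qed.

Lemma corner_T : O + r *: cis phi1 = T.
Proof.
have sh := lt0r_neq0 corner_sin_gt0.
have mE : m = phi1 + h by rewrite phi1E subrK.
by apply: plane_eqP; rewrite /O /r /= /GRing.scale /= mE ?cosD ?sinD; field.
Qed.

(** With [w] the angle measured from the bisector, the barycentric weights are [lS] at S, [lT] at T
    and [cos h * (cos w - cos h) / sin h ^+ 2] at [A]; the last is nonnegative because
    [|w| <= h]. *)
Lemma corner_arc_sub_triangle t : phi1 <= t <= phi2 ->
  convex_hull [set S; A; T] (O + r *: cis t).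
Proof.
move=> /andP[t1 t2].
have /andP[h0 h2] := h_bounds.
have sh := corner_sin_gt0; have sh' := lt0r_neq0 sh.
have ch := corner_cos_gt0.
pose w := t - m.
have cw : cos h <= cos w.
  apply: ler_cos_norm; last by have := pi_gt0 R; lra.
  by rewrite ler_norml; apply/andP; split; rewrite /w /m /h; lra.
have pi_pos := pi_gt0 R.
pose lS := (1 - cos (w + h)) / (2 * sin h ^+ 2).
pose lT := (1 - cos (w - h)) / (2 * sin h ^+ 2).
have den : 0 < 2 * sin h ^+ 2 by rewrite mulr_gt0// exprn_gt0.
have lS0 : 0 <= lS by rewrite divr_ge0 ?(ltW den)// subr_ge0 cos_le1.
have lT0 : 0 <= lT by rewrite divr_ge0 ?(ltW den)// subr_ge0 cos_le1.
have lST : 1 - (lS + lT) = cos h * (cos w - cos h) / sin h ^+ 2.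
  have -> : 1 - (lS + lT) = (sin h ^+ 2 - (1 - cos w * cos h)) / sin h ^+ 2.
    by rewrite /lS /lT cosD cosB; field.
  by rewrite sin2cos2; congr (_ / _); ring.
have lA0 : 0 <= 1 - (lS + lT).
  by rewrite lST divr_ge0 ?sqr_ge0// mulr_ge0 ?subr_ge0// ltW.
have lST0 : 0 <= lS + lT by rewrite addr_ge0.
have hS : convex_hull [set S; A; T] S by apply: sub_gen_smallest; left; left.
have hA : convex_hull [set S; A; T] A by apply: sub_gen_smallest; left; right.
have hT : convex_hull [set S; A; T] T by apply: sub_gen_smallest; right.
(* barycentric coordinates of the point of the arc *)
have bary : O + r *: cis t = A + lS *: (S - A) + lT *: (T - A).
  have tE : t = m + w by rewrite /w addrC subrK.
  rewrite phi1E phi2E tE /lS /lT.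
  by apply: plane_eqP; rewrite /O /r /= /GRing.scale /= !(cosB, sinB, cosD, sinD);
    field.
(* Segments combine two points at a time: S and T are first merged into [Q], which needs a nonzero
   total weight, and [Q] is then joined to [A]. *)
have [lST_eq0|lST_neq0] := eqVneq (lS + lT) 0.
  have lS_eq0 : lS = 0 by lra.
  have lT_eq0 : lT = 0 by lra.
  by rewrite bary lS_eq0 lT_eq0 !scale0r !addr0.
pose Q := (1 - lT / (lS + lT)) *: S + (lT / (lS + lT)) *: T.
have hQ : convex_hull [set S; A; T] Q.
  apply: (convex_hull_segment hS hT); exists (lT / (lS + lT)) => //=.
  rewrite in_itv/= divr_ge0//= ler_pdivrMr ?mul1r ?lerDr//.
  by rewrite lt_neqAle eq_sym lST_neq0.
apply: (convex_hull_segment hA hQ); exists (lS + lT); last first.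
  rewrite bary /Q; apply: plane_eqP; rewrite /= /GRing.scale /=; field;
    exact: lST_neq0.
by rewrite /= in_itv/= lST0 -subr_ge0.
Qed.

Lemma corner_tangent_arcs : tangent_arcs S A T !=set0.
Proof.
exists [set O + r *: cis t | t in `[phi1, phi2]], O, r, phi1, phi2; split=> //.
- split; first exact: corner_radius_gt0.
  by have := phi12; have := phi2_lt; have := pi_gt0 R => *;
    apply/andP; split; lra.
- by rewrite corner_S corner_T setUC.
- by move=> _ [t] /= + <-; rewrite in_itv/= => /corner_arc_sub_triangle.
- rewrite -{1}corner_S -{1}corner_T !(addrC O) !addrK !opprD opprK.
  rewrite !(addrA A) subrr !add0r.
  by split; rewrite /dotp /= /GRing.scale /=; ring.
Qed.

(* The two tangency conditions determine the centre, and the complementary arc of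
   the same circle is excluded because it leaves the triangle. *)
Lemma corner_tangent_arcP E : tangent_arcs S A T E ->
  [/\ E `<=` convex_hull [set S; A; T],
      forall p t, E p -> dotp p (cis t) <= dotp O (cis t) + r &
      forall y, Num.min T.2 S.2 <= y <= Num.max T.2 S.2 ->
        exists t, [/\ phi1 <= t <= phi2, E (O + r *: cis t) &
                      (O + r *: cis t).2 = y]].
Proof.
move=> [Q [s [a [b [[s0 /andP[ab b2pi]] EE endE Etri [orthS orthT]]]]]].
have l0 := lt0r_neq0 l_gt0.
have sh := corner_sin_gt0; have ch := corner_cos_gt0.
have r0 := corner_radius_gt0.
have s12 : sin (phi2 - phi1) != 0.
  rewrite gt_eqF// sin_gt0_pi//; have := phi12; have := phi2_lt => *.
  by apply/andP; split; lra.
(* The two tangency conditions make [v] orthogonal to the directions of both legs. These are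
   independent, with determinant [sin (phi2 - phi1)], so [v] vanishes. *)
pose v : plane R := O - Q.
have orth2 : v.2 * cos phi2 = v.1 * sin phi2.
  apply: (mulfI l0); move: orthS; rewrite -{1}corner_S opprD addrA subrr add0r.
  rewrite /dotp /v /= /GRing.scale /= => orthS.
  by lra.
have orth1 : v.2 * cos phi1 = v.1 * sin phi1.
  apply: (mulfI l0); move: orthT; rewrite -{1}corner_T opprB addrCA subrr addr0.
  rewrite /dotp /v /= /GRing.scale /= => orthT.
  by lra.
have v1 : v.1 = 0.
  apply/eqP; rewrite -(mulIr_eq0 _ (mulIf s12)) sinB; apply/eqP.
  transitivity (cos phi1 * (v.1 * sin phi2) - cos phi2 * (v.1 * sin phi1)).
    by ring.
  by rewrite -orth1 -orth2; ring.
have v2 : v.2 = 0.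
  apply/eqP; rewrite -(mulIr_eq0 _ (mulIf s12)) sinB; apply/eqP.
  transitivity (sin phi2 * (v.2 * cos phi1) - sin phi1 * (v.2 * cos phi2)).
    by ring.
  by rewrite orth1 orth2; ring.
have OE : Q = O by apply/esym/eqP; rewrite -subr_eq0; apply/eqP/plane_eqP.
subst Q.
have sE : s = r.
  have rr (t : R) : O + s *: cis a = O + r *: cis t -> s = r.
    move/addrI => /(congr1 (fun p => dotp p p)); rewrite /dotp /= /GRing.scale /=.
    have -> : s * cos a * (s * cos a) + s * sin a * (s * sin a) = s ^+ 2.
      by rewrite -[RHS]mulr1 -(cos2Dsin2 a); ring.
    have -> : r * cos t * (r * cos t) + r * sin t * (r * sin t) = r ^+ 2.
      by rewrite -[RHS]mulr1 -(cos2Dsin2 t); ring.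
    by move/eqP; rewrite eqrXn2 ?ltW// => /eqP.
  have : [set O + s *: cis a; O + s *: cis b] (O + s *: cis a) by left.
  by rewrite endE => -[]; rewrite -?corner_S -?corner_T => /rr.
subst s.
(* The triangle lies on the side of the chord ST that contains [A]. On the circle this means an
   angle within [h] of [m] modulo 2 pi. The normal is negated because hulls are bounded from above
   only. *)
have cosE t : a <= t <= b -> cos h <= cos (t - m).
  move=> atb.
  have Et : E (O + r *: cis t) by rewrite EE; exists t => //=; rewrite in_itv.
  have := @convex_hull_halfplane R [set S; A; T] (- cis m)
    (- (dotp O (cis m) + r * cos h)).
  have dotpNr p : dotp p (- cis m) = - dotp p (cis m) by rewrite /dotp /=; ring.
  move=> /(_ _ _ (Etri _ Et)); rewrite !dotpNr lerN2 dotpDl dotpZl dotp_cis.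
  rewrite lerD2l ler_pM2l// -(cosN (t - m)) opprB; apply.
  move=> p [[->|->]|->]; rewrite dotpNr lerN2.
  - by rewrite -corner_S dotpDl dotpZl dotp_cis phi2E opprD addNKr cosN.
  - have -> : dotp A (cis m) = dotp O (cis m) + l / sin h.
      by rewrite /O dotpBl dotpZl dotp_cis subrr cos0 mulr1 subrK.
    rewrite lerD2l /r mulrAC ler_pM2r ?invr_gt0//.
    by rewrite -mulrA ler_piMr ?(ltW l_gt0)// mulr_ile1 ?(ltW ch)// cos_le1.
  - by rewrite -corner_T dotpDl dotpZl dotp_cis phi1E subKr.
split=> //.
- move=> p t; rewrite EE => -[u _ <-].
  rewrite dotpDl dotpZl dotp_cis lerD2l.
  by rewrite -[leRHS]mulr1 ler_pM2l// cos_le1.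
move=> y yTS.
have ivt : Num.min (O.2 + r * sin a) (O.2 + r * sin b) <= y <=
           Num.max (O.2 + r * sin a) (O.2 + r * sin b).
  have Pa : [set S; T] (O + r *: cis a) by rewrite -endE; left.
  have Pb : [set S; T] (O + r *: cis b) by rewrite -endE; right.
  have PS : [set O + r *: cis a; O + r *: cis b] S by rewrite endE; left.
  have PT : [set O + r *: cis a; O + r *: cis b] T by rewrite endE; right.
  have : (O + r *: cis a = S /\ O + r *: cis b = T) \/
         (O + r *: cis a = T /\ O + r *: cis b = S).
    case: Pa Pb PS PT => [->|->] [->|->]; [|by left|by right|].
      by move=> _ [->|->]; left.
    by move=> [->|->]; left.
  have -> : O.2 + r * sin a = (O + r *: cis a).2 by [].
  have -> : O.2 + r * sin b = (O + r *: cis b).2 by [].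
  by case=> -[-> ->]; rewrite // minC maxC.
have cont : {within `[a, b], continuous (fun t => O.2 + r * sin t)}.
  apply: continuous_subspaceT => t.
  by apply: cvgD; [exact: cvg_cst|apply: cvgMr; exact: continuous_sin].
have [t] := IVT (ltW ab) cont ivt.
rewrite in_itv/= => tab ty.
have /andP[h0 hpi2] := h_bounds.
have hpi : h <= pi by have := pi_gt0 R; lra.
(* The intermediate value theorem gives an angle in the unnormalised interval of the arc; it is
   moved into [[phi1, phi2]] without changing the point. *)
have [u] := cis_reduce (ltW h0) hpi (cosE t tab).
rewrite -phi1E -phi2E => u12 ucis; exists u; split=> //.
  by rewrite ucis EE; exists t => //=; rewrite in_itv.
by rewrite -ty; have /= -> := congr1 snd ucis.
Qed.
End Corner.

(** * Support lines of the body *)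

Section Construction.
Variables (R : realType) (alpha : nat -> R).
Hypothesis halpha : defining_sequence alpha.
Implicit Types (n k : nat) (phi y : R) (p e : plane R).

Local Notation A := (ptA alpha).
Local Notation S := (ptS alpha).
Local Notation T := (ptT alpha).

Definition beta n : R := (alpha n + alpha n.+1) / 2.
Definition delta n : R := (alpha n - alpha n.+1) / 2.

Lemma alpha1 : alpha 1 = pi / 2. Proof. by case: halpha. Qed.

Lemma alpha_gt0 n : (1 <= n)%N -> 0 < alpha n.
Proof. by case: halpha => _ h _ _ _ /h/andP[]. Qed.

Lemma alpha_lt n k : (1 <= n)%N -> (n < k)%N -> alpha k < alpha n.
Proof.
case: halpha => _ _ h _ _ n1; elim: k => // k ih; rewrite ltnS leq_eqVlt.
move=> /predU1P[<-|nk]; first exact: h.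
by rewrite (lt_trans _ (ih nk))// h// (leq_trans n1 (ltnW nk)).
Qed.

Lemma alpha_le n k : (1 <= n)%N -> (n <= k)%N -> alpha k <= alpha n.
Proof.
move=> n1; rewrite leq_eqVlt => /predU1P[->//|nk]; exact/ltW/alpha_lt.
Qed.

Lemma alpha_le_pihalf n : (1 <= n)%N -> alpha n <= pi / 2.
Proof. by move=> n1; rewrite -alpha1 alpha_le. Qed.

Lemma beta_gt0 n : (1 <= n)%N -> 0 < beta n.
Proof. by move=> n1; rewrite divr_gt0// addr_gt0// alpha_gt0. Qed.

Lemma beta_lt_pihalf n : (1 <= n)%N -> beta n < pi / 2.
Proof.
move=> n1; have := alpha_le_pihalf n1; have := alpha_lt n1 (ltnSn n).
by rewrite /beta; lra.
Qed.

Lemma beta_lt n : (1 <= n)%N -> beta n.+1 < beta n.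
Proof.
move=> n1; have := alpha_lt n1 (ltnSn n); have := alpha_lt (ltn0Sn n) (ltnSn n.+1).
by rewrite /beta; lra.
Qed.

Lemma beta_le n k : (1 <= n)%N -> (n <= k)%N -> beta k <= beta n.
Proof.
by move=> n1 nk; rewrite /beta ler_pM2r// lerD// alpha_le.
Qed.

Lemma delta_gt0 n : (1 <= n)%N -> 0 < delta n.
Proof. by move=> n1; rewrite divr_gt0// subr_gt0 alpha_lt. Qed.

Lemma delta_le_piquarter n : (1 <= n)%N -> delta n <= pi / 4.
Proof.
move=> n1; have := alpha_le_pihalf n1; have := alpha_gt0 (ltn0Sn n).
by rewrite /delta; lra.
Qed.

(** The convexity condition on [alpha]: sides shorten as n grows, so the leg cut off above A_(n+1)
    fits into the lower half of the side above it. *)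
Lemma delta_le n : (1 <= n)%N -> delta n.+1 <= delta n.
Proof.
by case: halpha => _ _ _ _ h n1; have := h _ n1; rewrite /delta; lra.
Qed.

Lemma sin_delta_gt0 n : (1 <= n)%N -> 0 < sin (delta n).
Proof.
move=> n1; apply: sin_gt0_pihalf; have := delta_gt0 n1; have := delta_le_piquarter n1.
by have := pi_gt0 R => *; apply/andP; split; lra.
Qed.

Lemma sin_delta_le n : (1 <= n)%N -> sin (delta n.+1) <= sin (delta n).
Proof.
move=> n1; have := delta_gt0 n1; have := delta_le_piquarter n1.
have := delta_gt0 (ltn0Sn n); have := delta_le n1; have := pi_gt0 R => *.
by apply: ler_sin_pihalf; lra.
Qed.

Lemma alphaE n : alpha n = beta n + delta n.
Proof. by rewrite /beta /delta; field. Qed.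

Lemma alphaSE n : alpha n.+1 = beta n - delta n.
Proof. by rewrite /beta /delta; field. Qed.

Lemma ptA_line n : A n = A n.+1 + (2 * sin (delta n)) *: icis (beta n).
Proof.
apply: plane_eqP; rewrite /= /GRing.scale /= {1}alphaE alphaSE.
  by rewrite cosD cosB; ring.
by rewrite sinD sinB; ring.
Qed.

Lemma ptT_line n : T n = A n.+1 + sin (delta n) *: icis (beta n).
Proof.
rewrite /ptT ptA_line.
by apply: plane_eqP; rewrite /= /GRing.scale /=; field.
Qed.

Lemma ptT_corner n : T n.+1 = A n.+1 - sin (delta n.+1) *: icis (beta n.+1).
Proof.
rewrite ptT_line (ptA_line n.+1).
by apply: plane_eqP; rewrite /= /GRing.scale /=; field.
Qed.

Lemma enorm_icis a t : enorm (a *: icis t : plane R) = `|a|.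
Proof.
rewrite /enorm /dotp /= /GRing.scale /= -sqrtr_sqr; congr Num.sqrt.
by rewrite -[RHS]mulr1 -(cos2Dsin2 t); ring.
Qed.

Lemma segment_lineP n p : segment (A n) (A n.+1) p ->
  exists2 u, 0 <= u & p = A n.+1 + u *: (sin (delta n) *: icis (beta n)).
Proof.
move=> -[t]; rewrite /= in_itv/= => /andP[t0 t1] <-.
exists (2 * (1 - t)); first by rewrite mulr_ge0// subr_ge0.
rewrite {1}ptA_line.
by apply: plane_eqP; rewrite /= /GRing.scale /=; ring.
Qed.

(** Existence: [delta_le] puts the candidate on the segment. Uniqueness: the segment lies on a ray
    from A_(n+1), where the distance to A_(n+1) determines the point. *)
Lemma ptS_line n : (1 <= n)%N -> S n.+1 = A n.+1 + sin (delta n.+1) *: icis (beta n).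
Proof.
move=> n1; set Q := (RHS).
have s0 := sin_delta_gt0 n1; have s1 := sin_delta_gt0 (ltn0Sn n).
have s01 := sin_delta_le n1.
have nT : enorm (A n.+1 - T n.+1) = sin (delta n.+1).
  by rewrite ptT_corner opprB addrCA subrr addr0 enorm_icis gtr0_norm.
have nQ u : enorm (A n.+1 - (A n.+1 + u *: icis (beta n))) = `|u|.
  by rewrite opprD addrA subrr add0r -scaleNr enorm_icis normrN.
have : exists p, segment (A n.+1.-1) (A n.+1) p /\
                 enorm (A n.+1 - p) = enorm (A n.+1 - T n.+1).
  exists Q; split; last by rewrite nT nQ gtr0_norm.
  exists (1 - sin (delta n.+1) / (2 * sin (delta n))).
    rewrite /= in_itv/= subr_ge0 gerBl divr_ge0 ?mulr_ge0 ?(ltW s0) ?(ltW s1)//.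
    by rewrite andbT ler_pdivrMr ?mulr_gt0//; lra.
  rewrite subKr /= {1}ptA_line /Q.
  apply: plane_eqP; rewrite /= /GRing.scale /=; field; exact: lt0r_neq0.
move=> /getPex[]; rewrite -/(S n.+1) /= nT => /segment_lineP[u u0 ->].
rewrite scalerA nQ ger0_norm ?mulr_ge0 ?(ltW s0)// => ->.
by [].
Qed.

Definition arc_center n : plane R :=
  corner_center (A n.+1) (sin (delta n.+1)) (beta n.+1) (beta n).
Definition arc_radius n : R :=
  corner_radius (sin (delta n.+1)) (beta n.+1) (beta n).

Lemma beta_ltDpi n : (1 <= n)%N -> beta n < beta n.+1 + pi.
Proof.
move=> n1; have := beta_lt_pihalf n1; have := beta_gt0 (ltn0Sn n).
by have := pi_gt0 R; lra.
Qed.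

Lemma arc_radius_gt0 n : (1 <= n)%N -> 0 < arc_radius n.
Proof.
move=> n1; apply: corner_radius_gt0; [exact: sin_delta_gt0|exact: beta_lt|].
exact: beta_ltDpi.
Qed.

Lemma ptS_center n : (1 <= n)%N ->
  S n.+1 = arc_center n + arc_radius n *: cis (beta n).
Proof.
by move=> n1; rewrite corner_S ?ptS_line ?beta_lt ?beta_ltDpi ?sin_delta_gt0.
Qed.

Lemma ptT_center n : (1 <= n)%N ->
  T n.+1 = arc_center n + arc_radius n *: cis (beta n.+1).
Proof.
by move=> n1; rewrite corner_T ?ptT_corner ?beta_lt ?beta_ltDpi ?sin_delta_gt0.
Qed.

Lemma arcCP n : (1 <= n)%N ->
  [/\ arcC alpha n.+1 `<=` convex_hull [set S n.+1; A n.+1; T n.+1],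
      forall p t, arcC alpha n.+1 p ->
        dotp p (cis t) <= dotp (arc_center n) (cis t) + arc_radius n &
      forall y, (T n.+1).2 <= y <= (S n.+1).2 ->
        exists t, [/\ beta n.+1 <= t <= beta n,
          arcC alpha n.+1 (arc_center n + arc_radius n *: cis t) &
          (arc_center n + arc_radius n *: cis t).2 = y]].
Proof.
move=> n1.
have [d0 b1 b2] : [/\ 0 < sin (delta n.+1), beta n.+1 < beta n &
    beta n < beta n.+1 + pi].
  by split; [exact: sin_delta_gt0|exact: beta_lt|exact: beta_ltDpi].
have : tangent_arcs (S n.+1) (A n.+1) (T n.+1) !=set0.
  by rewrite (ptS_line n1) ptT_corner; exact: corner_tangent_arcs.
move=> /getPex; rewrite -/(arcC alpha n.+1) {1}(ptS_line n1) {1}ptT_corner.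
move=> /(corner_tangent_arcP d0 b1 b2); rewrite -(ptS_line n1) -ptT_corner.
move=> [sub dot arc]; split=> // y /andP[Ty yS]; apply: arc.
by rewrite ge_min le_max Ty yS orbT.
Qed.

Lemma ptA_dotp n phi : dotp (A n) (cis phi) = cos (phi - alpha n).
Proof. exact: dotp_cis. Qed.

Lemma line_dotp n u phi : dotp (A n.+1 + u *: icis (beta n)) (cis phi) =
  dotp (A n.+1) (cis phi) + u * sin (phi - beta n).
Proof. by rewrite dotpDl dotpZl dotp_icis. Qed.

Lemma line_dotp_le n u e c : 0 <= u -> u <= 2 * sin (delta n) ->
  dotp (A n) e <= c -> dotp (A n.+1) e <= c ->
  dotp (A n.+1 + u *: icis (beta n)) e <= c.
Proof.
rewrite (ptA_line n) !dotpDl !dotpZl => u0 us.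
have [x0 _ xh|x0 xh _] := leP (dotp (icis (beta n)) e) 0.
  by apply: le_trans xh; rewrite gerDl mulr_ge0_le0.
by apply: le_trans xh; rewrite lerD2l ler_pM2r.
Qed.

(** Arcs get their own hypothesis because a support line touching the arc at A_(n+1) may leave
    A_(n+1) outside; the triangle bound of [arcC_dotp] then fails, and the bound by the circle is
    needed. *)
Lemma J1_dotp e c : 0 <= c -> e.1 <= c -> dotp (A 1) e <= c ->
  (forall n, (1 <= n)%N -> dotp (S n.+1) e <= c) ->
  (forall n, (1 <= n)%N -> dotp (T n.+1) e <= c) ->
  (forall n p, (1 <= n)%N -> arcC alpha n.+1 p -> dotp p e <= c) ->
  forall p, J1 alpha p -> dotp p e <= c.
Proof.
move=> c0 e1 A1 Sc Tc arcc; apply: convex_hull_halfplane => p.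
case=> [[[[->|->]|]|]|].
- by rewrite /dotp/= !mul0r addr0.
- by rewrite /dotp/= mul0r mul1r addr0.
- by move=> [[|[|n]]]//= _ /arcc; apply.
- by move=> /segment_dotp; apply=> //; apply: Sc.
- by move=> [[|[|n]]]//= _ /segment_dotp; apply; [apply: Tc|apply: Sc].
Qed.

Lemma arcC_dotp n p e c : (1 <= n)%N -> arcC alpha n.+1 p ->
  dotp (S n.+1) e <= c -> dotp (A n.+1) e <= c -> dotp (T n.+1) e <= c ->
  dotp p e <= c.
Proof.
move=> n1 np Sc Ac Tc; have [/(_ _ np) + _ _] := arcCP n1.
move: {np} p; apply: convex_hull_halfplane.
by move=> p [[->|->]|->].
Qed.

Lemma angle_bounds n phi : (1 <= n)%N -> beta n.+1 <= phi <= beta n ->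
  0 < phi < pi / 2.
Proof.
move=> n1 /andP[? ?]; have := beta_lt_pihalf n1; have := beta_gt0 (ltn0Sn n).
by move=> *; apply/andP; split; lra.
Qed.

Section Support.
Variables (n : nat) (phi : R).
Hypotheses (n1 : (1 <= n)%N) (hphi : beta n.+1 <= phi <= beta n).

Local Notation h := (dotp (arc_center n) (cis phi) + arc_radius n).

Lemma support_S : dotp (S n.+1) (cis phi) <= h.
Proof.
rewrite (ptS_center n1) dotpDl dotpZl dotp_cis lerD2l.
by rewrite ler_piMr ?cos_le1// ltW// arc_radius_gt0.
Qed.

Lemma support_T : dotp (T n.+1) (cis phi) <= h.
Proof.
rewrite (ptT_center n1) dotpDl dotpZl dotp_cis lerD2l.
by rewrite ler_piMr ?cos_le1// ltW// arc_radius_gt0.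
Qed.

Let phi_bounds := angle_bounds n1 hphi.

Let sin_lower : sin (phi - beta n) <= 0.
Proof.
have /andP[p0 p1] := hphi; have /andP[? ?] := phi_bounds.
have := beta_lt_pihalf n1 => ?.
by rewrite -oppr_ge0 -sinN opprB sin_ge0_pi//; apply/andP; split; lra.
Qed.

Let sin_upper : 0 <= sin (phi - beta n.+1).
Proof.
have /andP[p0 p1] := hphi; have /andP[? ?] := phi_bounds.
have := beta_gt0 (ltn0Sn n) => ?.
by rewrite sin_ge0_pi//; apply/andP; split; lra.
Qed.

(** Since [phi <= beta n], moving up the side beyond S_(n+1) does not increase the component along
    [cis phi]. The next lemma is the mirror statement below T_(n+1). *)
Lemma support_upper_line u : sin (delta n.+1) <= u ->
  dotp (A n.+1 + u *: icis (beta n)) (cis phi) <= h.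
Proof.
move=> hu; apply: le_trans support_S.
by rewrite (ptS_line n1) !line_dotp lerD2l ler_wnM2r.
Qed.

Lemma support_lower_line u : u <= sin (delta n.+1) ->
  dotp (A n.+2 + u *: icis (beta n.+1)) (cis phi) <= h.
Proof.
move=> hu; apply: le_trans support_T.
by rewrite (ptT_line n.+1) !line_dotp lerD2l ler_wpM2r.
Qed.

(** Going up from A_n, the vertices turn further away from the direction [phi], so A_n is the worst
    case, and it lies on the side above S_(n+1). Below the arc, A_(n+2) plays the same role. *)
Lemma support_ptA_le k : (1 <= k)%N -> (k <= n)%N -> dotp (A k) (cis phi) <= h.
Proof.
move=> k1 kn; have /andP[p0 p1] := hphi; have /andP[q0 q1] := phi_bounds.
have h1 := alpha_le k1 kn; have h2 := alpha_le_pihalf k1.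
apply: (@le_trans _ _ (dotp (A n) (cis phi))).
  have := alphaE n; have := delta_gt0 n1 => d0 an.
  rewrite !ptA_dotp -(cosN (phi - alpha k)) -(cosN (phi - alpha n)) !opprB.
  by apply: ler_cos0pi; lra.
rewrite ptA_line; apply: support_upper_line.
have := sin_delta_le n1; have := sin_delta_gt0 n1; lra.
Qed.

Lemma support_ptA_ge k : (n.+1 < k)%N -> dotp (A k) (cis phi) <= h.
Proof.
move=> nk; have /andP[p0 p1] := hphi; have /andP[q0 q1] := phi_bounds.
have h1 := alpha_le (ltn0Sn n.+1) nk; have h2 := alpha_gt0 (ltn_trans (ltn0Sn n) nk).
apply: (@le_trans _ _ (dotp (A n.+2) (cis phi))).
  have := alphaSE n.+1; have := delta_gt0 (ltn0Sn n) => d0 an.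
  by rewrite !ptA_dotp; apply: ler_cos0pi; lra.
have := @support_lower_line 0; rewrite scale0r addr0; apply.
exact/ltW/sin_delta_gt0.
Qed.

Lemma support_dotp_ge0 : 0 <= h.
Proof.
apply: le_trans (support_ptA_ge (ltnSn n.+1)); rewrite ptA_dotp.
have /andP[p0 p1] := hphi; have /andP[q0 q1] := phi_bounds.
have := alphaSE n.+1; have := delta_gt0 (ltn0Sn n); have := alpha_gt0 (ltn0Sn n.+1).
by move=> *; apply: cos_ge0_pihalf; apply/andP; split; lra.
Qed.

(** A side not ending at A_(n+1) is controlled by its two vertices. The two sides meeting at A_(n+1)
    are controlled only outside the part that the arc replaces, hence the two conditions on [u]. *)
Lemma support_line k u : (1 <= k)%N -> 0 <= u -> u <= 2 * sin (delta k) ->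
  (k = n -> sin (delta n.+1) <= u) -> (k = n.+1 -> u <= sin (delta n.+1)) ->
  dotp (A k.+1 + u *: icis (beta k)) (cis phi) <= h.
Proof.
move=> k1 u0 u2 ukn uknS.
have [kn|nk|kn] := ltngtP k n.
- by apply: line_dotp_le => //; apply: support_ptA_le => //; exact: ltnW.
- move: nk; rewrite leq_eqVlt => /predU1P[nk|nk].
    by rewrite -nk; apply: support_lower_line; apply: uknS.
  by apply: line_dotp_le => //; apply: support_ptA_ge => //; exact: ltnW.
- by rewrite kn; apply: support_upper_line; apply: ukn.
Qed.

Lemma support_ptS k : (1 <= k)%N -> dotp (S k.+1) (cis phi) <= h.
Proof.
move=> k1; rewrite (ptS_line k1); have s0 := sin_delta_gt0 (ltn0Sn k).
have s1 := sin_delta_le k1; apply: support_line => //; [lra|lra|by move->|].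
by move=> ->; exact: sin_delta_le.
Qed.

Lemma support_ptT k : (1 <= k)%N -> dotp (T k.+1) (cis phi) <= h.
Proof.
move=> k1; rewrite ptT_line; have s0 := sin_delta_gt0 (ltn0Sn k).
apply: support_line => //; [lra|lra| |by move=> [->]].
by move=> <-; exact: sin_delta_le.
Qed.

Lemma J1_support p : J1 alpha p -> dotp p (cis phi) <= h.
Proof.
have /andP[p0 p1] := hphi; have /andP[q0 q1] := phi_bounds.
apply: J1_dotp.
- exact: support_dotp_ge0.
(* The point 1 is [cis 0], at a larger angle from [phi] than A_(n+2), as [0 < alpha n.+2 < phi]. *)
- apply: (@le_trans _ _ (dotp (A n.+2) (cis phi))); last first.
    exact: support_ptA_ge.
  rewrite ptA_dotp; have := alphaSE n.+1; have := delta_gt0 (ltn0Sn n).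
  have := alpha_gt0 (ltn0Sn n.+1) => *.
  by apply: ler_cos0pi; lra.
- exact: support_ptA_le.
- exact: support_ptS.
- exact: support_ptT.
move=> k q k1 kq; have [kn|nk|kn] := ltngtP k n.
- apply: (arcC_dotp k1 kq); [exact: support_ptS| |exact: support_ptT].
  exact: support_ptA_le.
- apply: (arcC_dotp k1 kq); [exact: support_ptS| |exact: support_ptT].
  exact: support_ptA_ge.
- by rewrite kn in kq; have [_ + _] := arcCP n1; exact.
Qed.

End Support.
Lemma J1_dotp_vertices e c : 0 <= c -> e.1 <= c ->
  (forall n, (1 <= n)%N -> dotp (A n) e <= c) ->
  forall p, J1 alpha p -> dotp p e <= c.
Proof.
move=> c0 e1 Ac.
have Sc n : (1 <= n)%N -> dotp (S n.+1) e <= c.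
  move=> n1; rewrite (ptS_line n1); have s0 := sin_delta_gt0 (ltn0Sn n).
  by have s1 := sin_delta_le n1; apply: line_dotp_le; rewrite ?Ac//; lra.
have Tc n : (1 <= n)%N -> dotp (T n.+1) e <= c.
  move=> n1; rewrite ptT_line; have s0 := sin_delta_gt0 (ltn0Sn n).
  by apply: line_dotp_le; rewrite ?Ac//; lra.
apply: J1_dotp => //; first exact: Ac.
by move=> n p n1 np; apply: (arcC_dotp n1 np); [exact: Sc|exact: Ac|exact: Tc].
Qed.

Lemma alpha_itv n : (1 <= n)%N -> 0 < alpha n <= pi / 2.
Proof. by move=> n1; rewrite alpha_gt0// alpha_le_pihalf. Qed.

Lemma J1_fst_ge0 p : J1 alpha p -> 0 <= p.1.
Proof.
move=> Jp; suff : dotp p (-1, 0) <= 0 by rewrite /dotp/=; lra.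
apply: J1_dotp_vertices Jp => //=.
move=> n n1; rewrite /dotp/= mulr0 addr0 mulrN1 oppr_le0.
apply: cos_ge0_pihalf; have /andP[? ?] := alpha_itv n1.
by have := pi_gt0 R => *; apply/andP; split; lra.
Qed.

Lemma J1_snd_ge0 p : J1 alpha p -> 0 <= p.2.
Proof.
move=> Jp; suff : dotp p (0, -1) <= 0 by rewrite /dotp/=; lra.
apply: J1_dotp_vertices Jp => //=.
move=> n n1; rewrite /dotp/= mulr0 add0r mulrN1 oppr_le0.
apply: sin_ge0_pi; have /andP[? ?] := alpha_itv n1.
by have := pi_gt0 R => *; apply/andP; split; lra.
Qed.

Lemma J1_fst_le1 p : J1 alpha p -> p.1 <= 1.
Proof.
move=> Jp; suff : dotp p (1, 0) <= 1 by rewrite /dotp/=; lra.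
apply: J1_dotp_vertices Jp => //= n n1.
by rewrite /dotp/= mulr0 addr0 mulr1 cos_le1.
Qed.

(** [J1] lies in the first quadrant, so absolute values undo the reflections and every bound on [J1]
    passes to [bodyK]. *)
Lemma bodyK_norm p : bodyK alpha p -> J1 alpha (`|p.1|, `|p.2|).
Proof.
have J1n q : J1 alpha q -> J1 alpha (`|q.1|, `|q.2|).
  move=> Jq; rewrite ger0_norm ?J1_fst_ge0// ger0_norm ?J1_snd_ge0//.
  by case: q Jq.
have J2n q : J2 alpha q -> J1 alpha (`|q.1|, `|q.2|).
  by move=> [x Jx <-]; rewrite /= normrN; exact: J1n.
move=> [[/J1n//|/J2n//]|[x Jx <-]].
by rewrite /= normrN; case: Jx => [/J1n|/J2n].
Qed.

Lemma bodyK_support n phi p : (1 <= n)%N -> beta n.+1 <= phi <= beta n ->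
  bodyK alpha p -> `|p.1| * cos phi + `|p.2| * sin phi <=
    dotp (arc_center n) (cis phi) + arc_radius n.
Proof. by move=> n1 hphi /bodyK_norm; exact: J1_support. Qed.

(* The side above the arc at [A_(n+1)] ends at [T_n], except that the first one
   ends at [A_1], of height 1. *)
Definition piece_top n : R := if n == 1%N then 1 else (T n).2.

(* The [n]-th piece of the profile is the arc at [A_(n+1)] followed by the side
   above it; [phi] is the normal angle at its point of height [y]. *)
Definition on_piece n y phi : Prop :=
  [/\ beta n.+1 <= phi <= beta n,
      exists2 p, J1 alpha p & p.2 = y /\
        dotp p (cis phi) = dotp (arc_center n) (cis phi) + arc_radius n &
      y = (arc_center n).2 + arc_radius n * sin phi \/
      phi = beta n /\ (S n.+1).2 <= y <= piece_top n].

Lemma cos_beta_gt0 n : (1 <= n)%N -> 0 < cos (beta n).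
Proof.
move=> n1; apply: cos_gt0_pihalf; have := beta_lt_pihalf n1; have := beta_gt0 n1.
by have := pi_gt0 R => *; apply/andP; split; lra.
Qed.

Lemma ptS_le_top n : (1 <= n)%N -> (S n.+1).2 <= piece_top n.
Proof.
move=> n1; have c0 := cos_beta_gt0 n1.
have s1 := sin_delta_le n1; have s0 := sin_delta_gt0 (ltn0Sn n).
rewrite /piece_top (ptS_line n1); case: eqVneq => [n1E|_].
  have -> : 1 = (A n).2 by rewrite n1E /= alpha1 sin_pihalf.
  rewrite (ptA_line n) /= /GRing.scale /=; nra.
rewrite ptT_line /= /GRing.scale /=; nra.
Qed.

Lemma piece_top_pt n : (1 <= n)%N -> exists q,
  [/\ q.2 = piece_top n, segment q (S n.+1) `<=` J1 alpha &
      dotp q (cis (beta n)) = dotp (S n.+1) (cis (beta n))].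
Proof.
move=> n1; have lineE u : dotp (A n.+1 + u *: icis (beta n)) (cis (beta n)) =
    dotp (A n.+1) (cis (beta n)) by rewrite line_dotp subrr sin0 mulr0 addr0.
rewrite /piece_top; case: eqVneq => [->|nn1].
  exists (A 1); split; first by rewrite /= alpha1 sin_pihalf.
    by move=> p pS; apply: sub_gen_smallest; left; right.
  by rewrite (ptA_line 1) ptS_line// !line_dotp subrr sin0 !mulr0.
exists (T n); split => //.
  move=> p pS; apply: sub_gen_smallest; right; exists n => //=.
  by case: n n1 nn1 {lineE pS} => [|[|]].
by rewrite ptT_line ptS_line// !lineE.
Qed.

Lemma on_piece_exists n y : (1 <= n)%N -> (T n.+1).2 <= y <= piece_top n ->
  exists phi, on_piece n y phi.
Proof.
move=> n1 /andP[Ty yt]; have [yS|Sy] := leP y (S n.+1).2.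
  have [_ _ arc] := arcCP n1.
  have [|phi [hphi Cphi yphi]] := arc y; first by rewrite Ty.
  exists phi; split=> //; last by left.
  eexists; last first.
    by split; [exact: yphi|rewrite dotpDl dotpZl dotp_cis subrr cos0 mulr1].
  by apply: sub_gen_smallest; left; left; right; exists n.+1.
exists (beta n); split; [by rewrite lexx ltW// beta_lt| |]; last first.
  by right; split=> //; rewrite (ltW Sy).
have [q [q2 qJ qdot]] := piece_top_pt n1.
have d0 : 0 < q.2 - (S n.+1).2 by rewrite q2 subr_gt0 (lt_le_trans Sy).
have dn0 := lt0r_neq0 d0.
pose t := (q.2 - y) / (q.2 - (S n.+1).2).
exists ((1 - t) *: q + t *: S n.+1).
  apply: qJ; exists t => //; rewrite /= in_itv/= divr_ge0 ?(ltW d0)//=; last first.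
    by rewrite q2 subr_ge0.
  by rewrite ler_pdivrMr// mul1r lerD2l lerN2 ltW.
split; first by rewrite /t /= /GRing.scale /=; field.
rewrite dotpDl !dotpZl qdot -mulrDl subrK mul1r (ptS_center n1).
by rewrite dotpDl dotpZl dotp_cis subrr cos0 mulr1.
Qed.

End Construction.

(** * Supergradients of the profile *)

Section BoundaryTopology.
Variable R : realType.
Implicit Types (p e : plane R) (X : set (plane R)).

Lemma closure_halfplane X e c : (forall p, X p -> dotp p e <= c) ->
  forall p, closure X p -> dotp p e <= c.
Proof.
move=> Xc p; rewrite closureE => /(_ [set q | dotp q e <= c]); apply.
split=> //=.
apply: (@preimage_closed _ _ (fun p => dotp p e) [set x | x <= c]); last first.
  exact: closed_le.
move=> q _; apply: (@cvgD R R); apply: (@cvgM R);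
  [exact: cvg_fst|exact: cvg_cst|exact: cvg_snd|exact: cvg_cst].
Qed.

Lemma support_boundary X p e : X p -> 0 < dotp e e ->
  (forall q, X q -> dotp q e <= dotp p e) -> boundary X p.
Proof.
move=> Xp e0 pe; split; first exact: subset_closure.
rewrite /interior => /nbhs_ballP[d /= d0 dX].
(* Balls are those of the sup norm; [M] exceeds both [|e.1|] and [|e.2|], so [t *: e] is shorter
   than [d]. *)
pose M := 1 + `|e.1| + `|e.2|.
have M0 : 0 < M by rewrite /M -addrA ltr_pwDl// addr_ge0.
pose t := d / M.
have t0 : 0 < t by rewrite divr_gt0.
have : X (p + t *: e).
  apply: dX; split => /=; rewrite /ball /= opprD addrA subrr add0r normrN.
    rewrite /GRing.scale/= normrM gtr0_norm// /t mulrAC ltr_pdivrMr// ltr_pM2l//.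
    by rewrite /M addrAC ltr_pwDl// ltrDr ltr_pwDl.
  rewrite /GRing.scale/= normrM gtr0_norm// /t mulrAC ltr_pdivrMr// ltr_pM2l//.
  by rewrite /M ltrDr ltr_pwDl.
move=> /pe; rewrite dotpDl dotpZl gerDl leNgt.
by rewrite mulr_gt0.
Qed.

End BoundaryTopology.

Section Profile.
Variables (R : realType) (alpha : nat -> R) (x : R -> R).
Hypotheses (halpha : defining_sequence alpha)
  (hx : [set ((x y, y) : plane R) | y in `[-1, 1]] =
        boundary (bodyK alpha) `&` [set p : plane R | 0 <= p.1]).

(** [hx] is read in both directions: the support point [p] is on the boundary, hence on the graph,
    and every graph point is in the closure, hence in the half-plane. Dividing by [e.1] gives the
    slope. *)
Lemma profile_supergradient e p : 0 < e.1 -> bodyK alpha p -> 0 <= p.1 ->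
  (forall q, bodyK alpha q -> dotp q e <= dotp p e) ->
  forall z, -1 <= z <= 1 -> x z <= x p.2 - e.2 / e.1 * (z - p.2).
Proof.
move=> e1 Kp p1 Kpe z hz.
have e0 : 0 < dotp e e by rewrite /dotp ltr_pwDl ?mulr_gt0// -expr2 sqr_ge0.
have : (boundary (bodyK alpha) `&` [set p : plane R | 0 <= p.1]) p.
  by split=> //; exact: support_boundary e0 Kpe.
rewrite -hx => -[y hy py]; have {}py : p = (x p.2, p.2) by rewrite -py.
have xp : p.1 = x p.2 by rewrite [in LHS]py.
have [[Kz _] _] : (boundary (bodyK alpha) `&` [set p : plane R | 0 <= p.1]) (x z, z).
  by rewrite -hx; exists z; rewrite //= in_itv.
have := closure_halfplane Kpe Kz; rewrite /dotp /= xp => h.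
rewrite -(ler_pM2r e1).
have -> : (x p.2 - e.2 / e.1 * (z - p.2)) * e.1 = x p.2 * e.1 - e.2 * (z - p.2).
  by field; exact: lt0r_neq0.
lra.
Qed.

(** The bound of [bodyK_support] involves only absolute values, so it also supports [bodyK] at the
    mirror point of height [- y], with the opposite slope. *)
Lemma on_piece_supergradient n y phi : (1 <= n)%N -> on_piece alpha n y phi ->
  forall z, -1 <= z <= 1 -> x z <= x y - tan phi * (z - y) /\
                           x z <= x (- y) + tan phi * (z + y).
Proof.
move=> n1 [hphi [p Jp [py pdot]] _] z hz.
have /andP[f0 f1] := angle_bounds halpha n1 hphi.
have c0 : 0 < cos phi by apply: cos_gt0_pihalf; apply/andP; split; lra.
have s0 : 0 < sin phi by apply: sin_gt0_pihalf; rewrite f0.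
have p0 := J1_fst_ge0 halpha Jp.
have Kp : bodyK alpha p by left; left.
have Kp' : bodyK alpha (reflect_real p) by left; right; exists p.
have bound q (s : R) : `|s| = sin phi -> bodyK alpha q ->
    q.1 * cos phi + q.2 * s <= dotp p (cis phi).
  move=> hs Kq; rewrite pdot; apply: le_trans (bodyK_support halpha n1 hphi Kq).
  rewrite -hs -normrM lerD ?ler_norm//.
  by rewrite ler_wpM2r ?ler_norm// ltW.
split.
- rewrite -py; apply: (@profile_supergradient (cis phi) p) => // q Kq.
  by apply: bound; rewrite ?gtr0_norm.
- have := fun h =>
    @profile_supergradient (cos phi, - sin phi) (reflect_real p) c0 Kp' p0 h z hz.
  rewrite /= -py mulNr mulNr opprK opprK; apply => // q Kq.
  rewrite [leRHS](_ : _ = dotp p (cis phi)); last by rewrite /dotp /=; ring.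
  by apply: bound; rewrite // normrN gtr0_norm.
Qed.

Lemma equator_supergradient z : -1 <= z <= 1 -> x z <= x 0.
Proof.
move=> hz.
have J : J1 alpha (1, 0) by apply: sub_gen_smallest; left; left; left; right.
have := @profile_supergradient (1, 0) (1, 0) ltr01 _ ler01 _ z hz.
rewrite /= mul0r mul0r subr0; apply; first by left; left.
move=> q Kq; rewrite /dotp/= !mulr0 !addr0 !mulr1.
by apply: le_trans (ler_norm _) _; have := J1_fst_le1 halpha (bodyK_norm halpha Kq).
Qed.

End Profile.

(** * Dependence of the normal angle on the height *)

Section TrigonometricBounds.
Variable R : realType.
Implicit Types a b c t x y : R.

Lemma sin_MVT x y : x <= y ->
  exists2 c, x <= c <= y & sin y - sin x = cos c * (y - x).
Proof.
move=> xy; have [c] := MVT_segment xy (fun z _ => is_derive_sin z)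
  (continuous_subspaceT (@continuous_sin R)).
by rewrite in_itv; exists c.
Qed.

Lemma tan_MVT x y : - (pi / 2) < x -> x <= y -> y < pi / 2 ->
  exists2 c, x <= c <= y & tan y - tan x = (cos c) ^- 2 * (y - x).
Proof.
move=> x0 xy y1.
have cz z : x <= z <= y -> cos z != 0.
  move=> /andP[xz zy]; apply/lt0r_neq0/cos_gt0_pihalf.
  by rewrite (lt_le_trans x0 xz) (le_lt_trans zy y1).
have [||c] := @MVT_segment R tan (fun z => (cos z) ^- 2) x y xy.
- move=> z; rewrite in_itv/= => /andP[xz zy]; apply: is_derive_tan; apply: cz.
  by rewrite !ltW.
- apply: continuous_in_subspaceT => z; rewrite inE/= in_itv/= => zxy.
  exact/continuous_tan/cz.
by rewrite in_itv; exists c.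
Qed.

Lemma sin_le_id x : 0 <= x -> sin x <= x.
Proof.
move=> x0; have [c _] := sin_MVT x0; rewrite sin0 !subr0 => ->.
by rewrite ler_piMl// cos_le1.
Qed.

Lemma sin_ge_linear b x : 0 <= x -> x <= b -> b <= pi -> cos b * x <= sin x.
Proof.
move=> x0 xb bpi; have [c /andP[c0 cx]] := sin_MVT x0; rewrite sin0 !subr0 => ->.
by rewrite ler_wpM2r// ler_cos0pi// (le_trans cx).
Qed.

Lemma tan_expanding x y : 0 <= x -> x <= y -> y < pi / 2 ->
  y - x <= tan y - tan x.
Proof.
move=> x0 xy y1; have x0' : - (pi / 2) < x.
  by rewrite (lt_le_trans _ x0)// oppr_lt0 divr_gt0// pi_gt0.
have [c /andP[xc cy] ->] := tan_MVT x0' xy y1.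
have c0 : 0 < cos c.
  by apply: cos_gt0_pihalf; rewrite (lt_le_trans x0' xc) (le_lt_trans cy y1).
rewrite ler_peMl ?subr_ge0// invf_ge1 ?exprn_gt0// expr_le1 ?cos_le1//.
Qed.

(** The mean value points for [tan] and [sin] may differ: the first contributes at most
    [(cos b) ^- 2], the second one more factor [(cos b)^-1]. *)
Lemma tan_le_sin b x y : 0 <= x -> x <= y -> y <= b -> b < pi / 2 ->
  tan y - tan x <= (cos b) ^- 3 * (sin y - sin x).
Proof.
move=> x0 xy yb b1; have pi0 := pi_gt0 R.
have b0 : 0 < cos b by apply: cos_gt0_pihalf; apply/andP; split; lra.
have cosb c : x <= c <= y -> cos b <= cos c.
  by move=> /andP[xc cy]; apply: ler_cos0pi; lra.
have x0' : - (pi / 2) < x by lra.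
have y1 : y < pi / 2 by lra.
have [c /cosb bc ->] := tan_MVT x0' xy y1.
have [d /cosb bd ->] := sin_MVT xy.
rewrite mulrA ler_wpM2r ?subr_ge0//.
have -> : (cos b) ^- 3 = (cos b) ^- 2 * (cos b)^-1 by rewrite -exprVn exprSr exprVn.
have c0 := lt_le_trans b0 bc.
rewrite -mulrA; apply: (@le_trans _ _ ((cos b) ^- 2)).
  by rewrite lef_pV2 ?posrE ?exprn_gt0// lerXn2r ?nnegrE// ltW.
by rewrite ler_peMr ?invr_ge0 ?exprn_ge0 ?(ltW b0)// mulrC ler_pdivlMr// mul1r.
Qed.

Lemma tan_lipschitz_sin b x y : 0 <= x <= b -> 0 <= y <= b -> b < pi / 2 ->
  `|tan y - tan x| <= (cos b) ^- 3 * `|sin y - sin x|.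
Proof.
wlog xy : x y / x <= y.
  move=> W xb yb b1; have [xy|/ltW yx] := leP x y; first exact: W.
  by rewrite distrC (distrC (sin y)); exact: W.
move=> /andP[x0 xb] /andP[y0 yb] b1.
rewrite ger0_norm; last first.
  rewrite (le_trans _ (tan_expanding x0 xy _)) ?subr_ge0//.
  exact: le_lt_trans yb b1.
rewrite ger0_norm; first exact: tan_le_sin.
by rewrite subr_ge0 ler_sin_pihalf//; have := pi_gt0 R; lra.
Qed.

End TrigonometricBounds.

Section Pieces.
Variables (R : realType) (alpha : nat -> R).
Hypothesis halpha : defining_sequence alpha.
Implicit Types (n k N : nat) (phi y rho : R).

Local Notation beta := (beta alpha).
Local Notation delta := (delta alpha).
Local Notation S := (ptS alpha).
Local Notation T := (ptT alpha).
Local Notation r := (arc_radius alpha).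
Local Notation top := (piece_top alpha).

Lemma ptST_drop n : (1 <= n)%N ->
  (S n.+1).2 - (T n.+1).2 = r n * (sin (beta n) - sin (beta n.+1)).
Proof.
move=> n1; rewrite (ptS_center halpha n1) (ptT_center halpha n1).
by rewrite /= /GRing.scale /=; ring.
Qed.

Lemma on_piece_sin n y phi : (1 <= n)%N -> on_piece alpha n y phi ->
  sin (beta n.+1) <= sin phi <= sin (beta n).
Proof.
move=> n1 [hphi _ _]; have /andP[f0 f1] := angle_bounds halpha n1 hphi.
have := beta_gt0 halpha (ltn0Sn n); have := beta_lt_pihalf halpha n1.
move: hphi => /andP[? ?] ? ?.
by apply/andP; split; apply: ler_sin_pihalf; lra.
Qed.

(** Equality holds along the arc; on the side above, [sin phi] stays at [sin (beta n)] while the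
    height still grows. *)
Lemma on_piece_bottom n y phi : (1 <= n)%N -> on_piece alpha n y phi ->
  r n * (sin phi - sin (beta n.+1)) <= y - (T n.+1).2.
Proof.
move=> n1 [_ _ [->|[-> /andP[Sy _]]]].
  by rewrite (ptT_center halpha n1) /= /GRing.scale /=; lra.
by rewrite -ptST_drop// lerD2r.
Qed.

Lemma on_piece_top n y phi : (1 <= n)%N -> on_piece alpha n y phi ->
  r n * (sin (beta n) - sin phi) <= top n - y.
Proof.
move=> n1 [_ _ [->|[-> /andP[_ yt]]]]; last by rewrite subrr mulr0 subr_ge0.
have := ptS_le_top halpha n1.
by rewrite (ptS_center halpha n1) /= /GRing.scale /=; lra.
Qed.

Lemma on_piece_bounds n y phi : (1 <= n)%N -> on_piece alpha n y phi ->
  (T n.+1).2 <= y <= top n.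
Proof.
move=> n1 yphi; have /andP[s0 s1] := on_piece_sin n1 yphi.
have r0 := arc_radius_gt0 halpha n1.
apply/andP; split; rewrite -subr_ge0.
  by apply: le_trans (on_piece_bottom n1 yphi); rewrite mulr_ge0 ?subr_ge0 ?(ltW r0).
by apply: le_trans (on_piece_top n1 yphi); rewrite mulr_ge0 ?subr_ge0 ?(ltW r0).
Qed.

Lemma on_piece_same n y phi y' phi' : (1 <= n)%N ->
  on_piece alpha n y phi -> on_piece alpha n y' phi' ->
  r n * `|sin phi - sin phi'| <= `|y - y'|.
Proof.
move=> n1; wlog ss : y phi y' phi' / sin phi' <= sin phi.
  move=> W yphi yphi'; have [ss|/ltW ss] := leP (sin phi') (sin phi).
    exact: W.
  by rewrite distrC (distrC y); exact: W.
move=> yphi yphi'; rewrite (@ger0_norm _ (_ - sin _)) ?subr_ge0//.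
have /andP[s0 s1] := on_piece_sin n1 yphi.
case: (yphi') => _ _ [y'E|[-> _]]; last first.
  by rewrite (le_trans _ (normr_ge0 _))// pmulr_rle0 ?arc_radius_gt0// subr_le0.
apply: le_trans (ler_norm _).
case: yphi => _ _ [->|[-> /andP[Sy _]]]; first by rewrite y'E; lra.
by move: Sy; rewrite y'E (ptS_center halpha n1) /= /GRing.scale /=; lra.
Qed.

Lemma ptT_drop n : (2 <= n)%N ->
  r n * (sin (beta n) - sin (beta n.+1)) <= (T n).2 - (T n.+1).2.
Proof.
move=> n2; have n1 := ltnW n2; rewrite -ptST_drop// lerD2r.
by have := ptS_le_top halpha n1; rewrite /piece_top gtn_eqF.
Qed.

(** Telescoping over whole pieces; [2 <= n] because the first piece ends at A_1 instead of T_1. *)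
Lemma ptT_drops rho N n m : (forall k, (1 <= k <= N)%N -> rho <= r k) ->
  (2 <= n)%N -> (n <= m)%N -> (m <= N.+1)%N ->
  rho * (sin (beta n) - sin (beta m)) <= (T n).2 - (T m).2.
Proof.
move=> hrho n2; elim: m => [|m ih].
  by rewrite leqn0 => /eqP ->; rewrite !subrr mulr0.
rewrite leq_eqVlt => /predU1P[->|]; first by rewrite !subrr mulr0.
rewrite ltnS => nm; rewrite ltnS => mN; have {}ih := ih nm (leqW mN).
have m2 := leq_trans n2 nm; have m1 := ltnW m2.
have hm : rho <= r m by apply: hrho; rewrite m1.
have bm := beta_lt halpha m1.
have sm : 0 <= sin (beta m) - sin (beta m.+1).
  rewrite subr_ge0; apply: ler_sin_pihalf; last exact/ltW/(beta_lt_pihalf halpha).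
    by have := beta_gt0 halpha (ltn0Sn m); have := pi_gt0 R; lra.
  exact: ltW.
have := ptT_drop m2; have := ler_wpM2r sm hm; lra.
Qed.

(** For [n < n'] the way down is split at the heights of T_(n+1) and T_(n'), giving a partial piece,
    whole pieces and a partial piece. The bound [N] allows for radii without a positive lower
    bound. *)
Lemma on_piece_lipschitz rho N n n' y phi y' phi' : 0 < rho ->
  (forall k, (1 <= k <= N)%N -> rho <= r k) ->
  (1 <= n <= N)%N -> (1 <= n' <= N)%N ->
  on_piece alpha n y phi -> on_piece alpha n' y' phi' ->
  rho * `|sin phi - sin phi'| <= `|y - y'|.
Proof.
move=> rho0 hrho; wlog nn' : n n' y phi y' phi' / (n <= n')%N.
  move=> W nN n'N yphi yphi'; have [nn'|/ltnW n'n] := leqP n n'.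
    exact: (W n n').
  by rewrite distrC (distrC y); exact: (W n' n).
move=> nN n'N yphi yphi'; have [n1 _] := andP nN; have [n1' n'leN] := andP n'N.
move: nn'; rewrite leq_eqVlt => /predU1P[nn'|nn'].
  rewrite -nn' in yphi'; apply: le_trans (on_piece_same n1 yphi yphi').
  by rewrite ler_wpM2r// hrho.
have /andP[s0 s1] := on_piece_sin n1 yphi.
have /andP[s0' s1'] := on_piece_sin n1' yphi'.
have bot := on_piece_bottom n1 yphi.
have n'top : top n' = (T n').2 by rewrite /piece_top gtn_eqF// (leq_trans _ nn').
have tp := on_piece_top n1' yphi'; rewrite n'top in tp.
have mid := @ptT_drops rho N n.+1 n' hrho n1 nn' (leqW n'leN).
have hn := hrho _ nN; have hn' := hrho _ n'N.
have ms : sin (beta n') <= sin (beta n.+1).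
  have := beta_le halpha (ltn0Sn n) nn'; have := beta_gt0 halpha n1'.
  have := beta_lt_pihalf halpha (ltn0Sn n); have := pi_gt0 R => *.
  by apply: ler_sin_pihalf; lra.
rewrite ger0_norm; last by lra.
apply: le_trans (ler_norm _).
have s0p : 0 <= sin phi - sin (beta n.+1) by rewrite subr_ge0.
have s0p' : 0 <= sin (beta n') - sin phi' by rewrite subr_ge0.
have := ler_wpM2r s0p hn; have := ler_wpM2r s0p' hn'; lra.
Qed.

Lemma radius_lower_bound N : exists2 rho, 0 < rho &
  forall k, (1 <= k <= N)%N -> rho <= r k.
Proof.
elim: N => [|N [rho rho0 hrho]]; first by exists 1 => // -[].
exists (Num.min rho (r N.+1)); first by rewrite lt_min rho0 arc_radius_gt0.
move=> k /andP[k1]; rewrite leq_eqVlt => /predU1P[->|kN].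
  by rewrite ge_min lexx orbT.
by rewrite ge_min hrho// k1.
Qed.

Lemma ptT_snd_gt0 n : (1 <= n)%N -> 0 < (T n).2.
Proof.
move=> n1; rewrite /ptT /= /GRing.scale /= mulr_gt0// addr_gt0//.
  apply: sin_gt0_pi; rewrite alpha_gt0//; have := alpha_le_pihalf halpha n1.
  by have := pi_gt0 R; lra.
apply: sin_gt0_pi; rewrite alpha_gt0//; have := alpha_le_pihalf halpha (ltn0Sn n).
by have := pi_gt0 R; lra.
Qed.

Lemma sin_alpha_le n m : (1 <= n)%N -> (n <= m)%N -> sin (alpha m) <= sin (alpha n).
Proof.
move=> n1 nm; have := alpha_le halpha n1 nm; have := alpha_le_pihalf halpha n1.
have := alpha_gt0 halpha (leq_trans n1 nm); have := pi_gt0 R => *.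
by apply: ler_sin_pihalf; lra.
Qed.

Lemma ptT_snd_le n m : (1 <= n)%N -> (n <= m)%N -> (T m).2 <= (T n).2.
Proof.
move=> n1 nm; rewrite /ptT /= /GRing.scale /= ler_pM2l ?invr_gt0//.
by rewrite lerD// sin_alpha_le.
Qed.

Lemma ptT_snd_le_alpha n : (1 <= n)%N -> (T n).2 <= alpha n.
Proof.
move=> n1; have := sin_alpha_le n1 (leqnSn n).
have := sin_le_id (ltW (alpha_gt0 halpha n1)).
by rewrite /ptT /= /GRing.scale /=; lra.
Qed.

Lemma alpha_lt_eps eps : 0 < eps -> exists2 n, (1 <= n)%N & alpha n < eps.
Proof.
move=> eps0; case: halpha => _ _ _ /cvgrPdist_lt/(_ _ eps0)[N _ hN] _.
exists N.+1 => //; have := hN N.+1 (leqnSn N).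
by rewrite /= sub0r normrN gtr0_norm// alpha_gt0.
Qed.

Lemma on_some_piece y : 0 < y <= 1 ->
  exists n phi, (1 <= n)%N /\ on_piece alpha n y phi.
Proof.
move=> /andP[y0 y1].
(* The least such n works: by minimality [y] lies below T_n, unless n is 1, whose piece reaches
   height 1. *)
have ex : exists n, (1 <= n)%N && ((T n.+1).2 <= y).
  have [n n1 ny] := alpha_lt_eps y0; exists n; rewrite n1/=.
  rewrite (le_trans (ptT_snd_le n1 (leqnSn n)))//.
  by rewrite (le_trans (ptT_snd_le_alpha n1))// ltW.
case: (ex_minnP ex) => n /andP[n1 Ty] nmin.
suff [phi yphi] : exists phi, on_piece alpha n y phi by exists n, phi.
apply: on_piece_exists => //; rewrite Ty/= /piece_top; case: eqVneq => // nn1.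
rewrite leNgt; apply/negP => yT.
case: n n1 nn1 nmin {Ty} yT => [|[|n]]// _ _ nmin yT.
by have := nmin n.+1; rewrite /= (ltW yT) ltnn => /(_ isT).
Qed.

End Pieces.

(** * The slope function *)

Section Slope.
Variables (R : realType) (alpha : nat -> R).
Hypothesis halpha : defining_sequence alpha.
Implicit Types (n k N : nat) (phi y z rho eps : R).

Local Notation beta := (beta alpha).
Local Notation delta := (delta alpha).
Local Notation S := (ptS alpha).
Local Notation T := (ptT alpha).
Local Notation r := (arc_radius alpha).

(* [t y] is [- x' y] for [y] in [0, 1]. *)
Definition is_slope (t : R -> R) : Prop :=
  t 0 = 0 /\ forall y, 0 < y <= 1 ->
    exists n phi, [/\ (1 <= n)%N, on_piece alpha n y phi & t y = tan phi].

Lemma slope_exists : exists t, is_slope t.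
Proof.
have pick y : exists v, (y = 0 -> v = 0) /\ (0 < y <= 1 -> exists n phi,
    [/\ (1 <= n)%N, on_piece alpha n y phi & v = tan phi]).
  have [/(on_some_piece halpha)[n [phi [n1 yphi]]]|y01] := boolP (0 < y <= 1).
    exists (tan phi); split; last by exists n, phi.
    move=> y0; have := on_piece_bounds halpha n1 yphi; rewrite y0 => /andP[T0 _].
    by have := ptT_snd_gt0 halpha (ltn0Sn n); rewrite ltNge T0.
  by exists 0; split=> //; rewrite (negbTE y01).
have [t ht] := choice pick; exists t; split; first exact: (ht 0).1.
by move=> y; exact: (ht y).2.
Qed.

(** The constant of [tan_lipschitz_sin] for [beta 1], the largest normal angle on any piece. *)
Definition tan_const : R := (cos (beta 1)) ^- 3.

Lemma tan_const_gt0 : 0 < tan_const.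
Proof. by rewrite invr_gt0 exprn_gt0// cos_beta_gt0. Qed.

Lemma on_piece_angle n y phi : (1 <= n)%N -> on_piece alpha n y phi ->
  0 <= phi <= beta 1.
Proof.
move=> n1 [hphi _ _]; have /andP[/ltW-> _] := angle_bounds halpha n1 hphi.
by have /andP[_ /le_trans->] := hphi => //; exact: beta_le.
Qed.

Lemma on_piece_tan_lipschitz rho N n n' y phi y' phi' : 0 < rho ->
  (forall k, (1 <= k <= N)%N -> rho <= r k) ->
  (1 <= n <= N)%N -> (1 <= n' <= N)%N ->
  on_piece alpha n y phi -> on_piece alpha n' y' phi' ->
  `|tan phi - tan phi'| <= tan_const / rho * `|y - y'|.
Proof.
move=> rho0 hrho nN n'N yphi yphi'.
have [n1 _] := andP nN; have [n1' _] := andP n'N.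
have := on_piece_lipschitz halpha rho0 hrho nN n'N yphi yphi'.
have := tan_lipschitz_sin (on_piece_angle n1' yphi') (on_piece_angle n1 yphi)
  (beta_lt_pihalf halpha (ltnSn 0)).
move=> ht hs; apply: (le_trans ht); rewrite -mulrA ler_pM2l ?tan_const_gt0//.
by rewrite mulrC ler_pdivlMr// mulrC.
Qed.

(** The Lipschitz bound at equal heights. It makes the slope independent of the chosen piece,
    notably where adjacent pieces meet. *)
Lemma on_piece_tan_uniq n n' y phi phi' : (1 <= n)%N -> (1 <= n')%N ->
  on_piece alpha n y phi -> on_piece alpha n' y phi' -> tan phi = tan phi'.
Proof.
move=> n1 n1' yphi yphi'; pose N := maxn n n'.
have [rho rho0 hrho] := radius_lower_bound halpha N.
have nN : (1 <= n <= N)%N by rewrite n1 leq_maxl.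
have n'N : (1 <= n' <= N)%N by rewrite n1' leq_maxr.
have := on_piece_tan_lipschitz rho0 hrho nN n'N yphi yphi'.
by rewrite subrr normr0 mulr0 normr_le0 subr_eq0 => /eqP.
Qed.

Lemma on_piece_ptS n : (1 <= n)%N -> on_piece alpha n (S n.+1).2 (beta n).
Proof.
move=> n1; split; first by rewrite lexx ltW// beta_lt.
  have [q [_ qJ _]] := piece_top_pt halpha n1.
  exists (S n.+1); last first.
    split=> //.
    by rewrite (ptS_center halpha n1) dotpDl dotpZl dotp_cis subrr cos0 mulr1.
  by apply: qJ; exact: segment_r.
by left; rewrite (ptS_center halpha n1).
Qed.

Lemma on_piece_ptT n : (1 <= n)%N -> on_piece alpha n (T n.+1).2 (beta n.+1).
Proof.
move=> n1; split; first by rewrite lexx ltW// beta_lt.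
  exists (T n.+1); last first.
    split=> //.
    by rewrite (ptT_center halpha n1) dotpDl dotpZl dotp_cis subrr cos0 mulr1.
  by apply: sub_gen_smallest; right; exists n.+1 => //; exact: segment_l.
by left; rewrite (ptT_center halpha n1).
Qed.

Lemma ptS_snd_itv n : (1 <= n)%N -> 0 < (S n.+1).2 <= alpha n.
Proof.
move=> n1; have := ptST_drop halpha n1; have := ptT_snd_gt0 halpha (ltn0Sn n).
have /andP[s0 _] := on_piece_sin halpha n1 (on_piece_ptS n1).
have := mulr_ge0 (ltW (arc_radius_gt0 halpha n1))
  (_ : 0 <= sin (beta n) - sin (beta n.+1)).
rewrite subr_ge0 => /(_ s0) *; apply/andP; split; first by lra.
have dotE p : p.2 = dotp p (0, 1) by rewrite /dotp/=; ring.
rewrite dotE (ptS_line halpha n1).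
have := sin_delta_le halpha n1; have := sin_delta_gt0 halpha (ltn0Sn n) => *.
have an := sin_le_id (ltW (alpha_gt0 halpha n1)).
have san := sin_alpha_le halpha n1 (leqnSn n).
apply: line_dotp_le; rewrite -?dotE /=; lra.
Qed.

Section GivenSlope.
Variable t : R -> R.
Hypothesis ht : is_slope t.

Lemma slope0 : t 0 = 0. Proof. exact: ht.1. Qed.

Lemma slope_piece n y phi : (1 <= n)%N -> y <= 1 -> on_piece alpha n y phi ->
  t y = tan phi.
Proof.
move=> n1 y1 yphi; have /andP[Ty _] := on_piece_bounds halpha n1 yphi.
have y0 := lt_le_trans (ptT_snd_gt0 halpha (ltn0Sn n)) Ty.
have [|m [psi [m1 ypsi ->]]] := ht.2 y; first by rewrite y0.
exact: on_piece_tan_uniq ypsi yphi.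
Qed.

Lemma slope_ge0 y : 0 <= y <= 1 -> 0 <= t y.
Proof.
rewrite le_eqVlt andb_orl => /orP[/andP[/eqP<- _]|/ht.2]; first by rewrite slope0.
move=> [n [phi [n1 yphi ->]]]; have /andP[p0 p1] := on_piece_angle n1 yphi.
have b1 := beta_lt_pihalf halpha (ltnSn 0).
have := tan_expanding (lexx 0) p0 (le_lt_trans p1 b1).
by rewrite tan0 !subr0; exact: le_trans.
Qed.

(** Only the first [N] pieces occur above T_(N+1); the inequality is strict because that point also
    belongs to the next piece. *)
Lemma slope_lipschitz_above N rho : (1 <= N)%N -> 0 < rho ->
  (forall k, (1 <= k <= N)%N -> rho <= r k) ->
  forall y z, (T N.+1).2 < y <= 1 -> (T N.+1).2 < z <= 1 ->
  `|t y - t z| <= tan_const / rho * `|y - z|.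
Proof.
move=> N1 rho0 hrho y z hy hz.
have piece w : (T N.+1).2 < w <= 1 -> exists n phi,
    [/\ (1 <= n <= N)%N, on_piece alpha n w phi & t w = tan phi].
  move=> /andP[Tw w1]; have w0 := lt_trans (ptT_snd_gt0 halpha (ltn0Sn N)) Tw.
  have [|n [phi [n1 wphi tw]]] := ht.2 w; first by rewrite w0.
  exists n, phi; split=> //; rewrite n1/= leqNgt; apply/negP => Nn.
  have /andP[_] := on_piece_bounds halpha n1 wphi.
  rewrite /piece_top; case: eqVneq => [n1E|_].
    by move: Nn N1; rewrite n1E ltnS leqn0 => /eqP->.
  by rewrite leNgt (le_lt_trans _ Tw)// ptT_snd_le.
have [n [phi [nN yphi ->]]] := piece y hy.
have [m [psi [mN zpsi ->]]] := piece z hz.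
exact: (on_piece_tan_lipschitz rho0 hrho nN mN yphi zpsi).
Qed.

(** Below T_n only pieces of index at least n occur, and their normal angles are at most
    [beta n < alpha n]. *)
Lemma slope_small eps : 0 < eps -> exists2 e, 0 < e &
  forall z, 0 <= z <= 1 -> z < e -> t z <= eps.
Proof.
move=> eps0; have e0 : 0 < eps / tan_const by rewrite divr_gt0// tan_const_gt0.
have [n n1 ne] := alpha_lt_eps halpha e0; exists (T n).2; first exact: ptT_snd_gt0.
move=> z /andP[]; rewrite le_eqVlt => /predU1P[<-|z0] z1 zT.
  by rewrite slope0 ltW.
have [|m [phi [m1 zphi ->]]] := ht.2 z; first by rewrite z0.
have nm : (n <= m)%N.
  rewrite leqNgt; apply/negP => mn; have := on_piece_bounds halpha m1 zphi.
  by rewrite leNgt (lt_le_trans zT)//= ptT_snd_le.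
have pa : 0 <= phi <= beta 1 by exact: on_piece_angle zphi.
have b1 := beta_lt_pihalf halpha (ltnSn 0).
have zb : 0 <= (0 : R) <= beta 1 by rewrite lexx ltW// beta_gt0.
have := tan_lipschitz_sin zb pa b1; rewrite tan0 sin0 !subr0 => ht'.
apply: (le_trans (ler_norm _)); apply: (le_trans ht').
have /andP[p0 p1] := pa; have pi0 := pi_gt0 R.
rewrite ger0_norm; last by apply: sin_ge0_pi; apply/andP; split; lra.
rewrite mulrC -ler_pdivlMr ?tan_const_gt0//.
apply: (le_trans (sin_le_id p0)); apply: le_trans (ltW ne).
have [/andP[_ pb] _ _] := zphi; apply: (le_trans pb).
have := beta_le halpha n1 nm; have := alphaE alpha n; have := delta_gt0 halpha n1.
lra.
Qed.

Lemma slope_continuous y eps : 0 <= y <= 1 -> 0 < eps -> exists2 e, 0 < e &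
  forall z, 0 <= z <= 1 -> `|z - y| < e -> `|t z - t y| <= eps.
Proof.
move=> /andP[]; rewrite le_eqVlt => /predU1P[<- _|y0 y1] eps0.
  have [e e0 he] := slope_small eps0; exists e => // z z01.
  rewrite subr0 slope0 subr0; have /andP[z0 _] := z01.
  by rewrite !ger0_norm ?slope_ge0//; exact: he.
have y2 : 0 < y / 2 by rewrite divr_gt0.
have [n n1 ny] := alpha_lt_eps halpha y2.
have [rho rho0 hrho] := radius_lower_bound halpha n.
have Ty : (T n.+1).2 < y / 2.
  apply: le_lt_trans ny; apply: le_trans (ptT_snd_le_alpha halpha n1).
  exact: ptT_snd_le.
have c0 : 0 < tan_const / rho by rewrite divr_gt0// tan_const_gt0.
exists (Num.min (y / 2) (eps / (tan_const / rho))).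
  by rewrite lt_min y2 divr_gt0.
move=> z /andP[z0 z1]; rewrite lt_min => /andP[zy ze].
apply: (le_trans (slope_lipschitz_above n1 rho0 hrho _ _)).
- by rewrite z1 andbT; move: zy; rewrite ltr_norml => /andP[zy _]; lra.
- by rewrite y1 andbT; lra.
- by rewrite mulrC -ler_pdivlMr// ltW.
Qed.

Lemma slope_lipschitz rho : 0 < rho -> (forall k, (1 <= k)%N -> rho <= r k) ->
  forall y z, 0 <= y <= 1 -> 0 <= z <= 1 ->
  `|t y - t z| <= tan_const / rho * `|y - z|.
Proof.
move=> rho0 hrho y z.
have c0 : 0 < tan_const / rho by rewrite divr_gt0// tan_const_gt0.
wlog yz : y z / y <= z.
  move=> W y01 z01; have [yz|/ltW zy] := leP y z; first exact: W.
  by rewrite distrC (distrC y); exact: W.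
have pos a b : 0 < a <= 1 -> 0 < b <= 1 -> `|t a - t b| <= tan_const / rho * `|a - b|.
  move=> /andP[a0 a1] /andP[b0 b1].
  have m0 : 0 < Num.min a b by rewrite lt_min a0.
  have [n n1] := alpha_lt_eps halpha m0; rewrite lt_min => /andP[na nb].
  have Tn : (T n.+1).2 <= alpha n.
    apply: le_trans (ptT_snd_le_alpha halpha n1); exact: ptT_snd_le.
  apply: (@slope_lipschitz_above n) => //; first by move=> k /andP[/hrho].
    by rewrite (le_lt_trans Tn).
  by rewrite (le_lt_trans Tn).
move=> /andP[]; rewrite le_eqVlt => /predU1P[<-|y0] y1 /andP[z0 z1]; last first.
  by apply: pos; rewrite ?y0// z1 (lt_le_trans y0).
move: z0; rewrite le_eqVlt => /predU1P[<-|z0]; first by rewrite !subrr normr0 mulr0.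
rewrite slope0 !sub0r !normrN (ger0_norm (ltW z0)) ger0_norm; last first.
  by rewrite slope_ge0// ltW.
(* Height 0 is on no piece, so it is approached by a small [w] with [t w <= eps]. *)
apply/ler_addgt0Pr => eps eps0; have [e e0 he] := slope_small eps0.
pose w := Num.min z (e / 2).
have w0 : 0 < w by rewrite lt_min z0 divr_gt0.
have wz : w <= z by rewrite ge_min lexx.
have we : w < e.
  by rewrite (@le_lt_trans _ _ (e / 2)) ?ge_min ?lexx ?orbT//; lra.
have w1 : w <= 1 by exact: le_trans wz z1.
have tw : t w <= eps by apply: he; rewrite ?w1 ?andbT// ltW.
have := @pos z w; rewrite z0 z1 w0 w1 => /(_ isT isT).
rewrite (@ger0_norm _ (z - w)) ?subr_ge0// => /(le_trans (ler_norm _)).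
nra.
Qed.

End GivenSlope.
End Slope.

(** * Derivatives from supergradients, and the odd extension of the slope *)

Section Calculus.
Variable R : realType.
Implicit Types (f d t : R -> R) (y z eps L : R) (D : set R).

(* Adding the supergradient inequalities at [y] and [z] places the difference
   quotient between [d y] and [d z]. *)
Lemma supergradient_derivative D f d :
  (forall y z, D y -> D z -> f z <= f y + d y * (z - y)) ->
  {within D, continuous d} -> is_derivative_on D f d.
Proof.
move=> fd /subspace_continuousP dc y Dy; apply/cvgrPdist_le => eps eps0.
have /cvgrPdist_le/(_ _ eps0) := dc y Dy.
rewrite near_withinE => H.
change (nbhs y [set z | z != y -> D z ->
  `|d y - (f z - f y) / (z - y)| <= eps]).
apply: filterS H => z H zy Dz; apply: le_trans (H Dz : `|d y - d z| <= eps).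
have := fd y z Dy Dz; have := fd z y Dz Dy => h1 h2.
have q1 : (f z - f y) / (z - y) * (z - y) = f z - f y.
  by rewrite divfK// subr_eq0.
set q := (_ / _) in q1 *.
have [zy0|yz0|zyE] := ltgtP z y; last by rewrite zyE eqxx in zy.
  have q2 : d y <= q.
    by rewrite -(ler_nM2r (_ : z - y < 0)) ?q1 ?subr_lt0//; lra.
  have q3 : q <= d z.
    by rewrite -(ler_nM2r (_ : z - y < 0)) ?q1 ?subr_lt0//; lra.
  by rewrite !ler0_norm ?subr_le0//; lra.
have q2 : q <= d y.
  by rewrite -(ler_pM2r (_ : 0 < z - y)) ?q1 ?subr_gt0//; lra.
have q3 : d z <= q.
  by rewrite -(ler_pM2r (_ : 0 < z - y)) ?q1 ?subr_gt0//; lra.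
by rewrite !ger0_norm ?subr_ge0//; lra.
Qed.

Definition odd_slope t y : R := if 0 <= y then - t y else t (- y).

Lemma odd_slope_same_side t y z : `|z - y| < `|y| ->
  `|odd_slope t z - odd_slope t y| = `|t `|z| - t `|y| |.
Proof.
rewrite /odd_slope; have [y0|y0] := leP 0 y; have [z0|z0] := leP 0 z => zy.
- by rewrite (ger0_norm y0) (ger0_norm z0) opprK addrC distrC.
- by move: zy; rewrite (ger0_norm y0) ltr_norml => /andP[? ?]; lra.
- by move: zy; rewrite (ltr0_norm y0) ltr_norml => /andP[? ?]; lra.
- by rewrite (ltr0_norm y0) (ltr0_norm z0).
Qed.

Lemma norm_odd_slope t y : `|odd_slope t y| = `|t `|y| |.
Proof.
rewrite /odd_slope; have [y0|y0] := leP 0 y; first by rewrite normrN (ger0_norm y0).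
by rewrite (ltr0_norm y0).
Qed.

Lemma odd_slope_continuous t : t 0 = 0 ->
  (forall y eps, 0 <= y <= 1 -> 0 < eps -> exists2 e, 0 < e &
    forall z, 0 <= z <= 1 -> `|z - y| < e -> `|t z - t y| <= eps) ->
  {within `[-1, 1], continuous (odd_slope t)}.
Proof.
move=> t0 tc; apply/subspace_continuousP => y; rewrite /= in_itv/= => hy.
have norm1 (w : R) : -1 <= w <= 1 -> 0 <= `|w| <= 1 by rewrite normr_ge0 ler_norml.
apply/cvgrPdist_le => eps eps0; rewrite near_withinE.
have [e e0 he] := tc `|y| eps (norm1 _ hy) eps0.
have [y0|y0] := eqVneq y 0.
  apply/nbhs_ballP; exists e => // z /=; rewrite y0 /ball/= sub0r normrN => ze.
  rewrite in_itv/= => hz.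
  have d0 : odd_slope t 0 = 0 by rewrite /odd_slope lexx t0 oppr0.
  change (`|odd_slope t 0 - odd_slope t z| <= eps).
  rewrite d0 sub0r normrN norm_odd_slope.
  have := he `|z| (norm1 _ hz); rewrite y0 normr0 t0 !subr0 normr_id; exact.
have m0 : 0 < Num.min e `|y| by rewrite lt_min e0 normr_gt0.
apply/nbhs_ballP; exists (Num.min e `|y|) => // z /=; rewrite /ball/= distrC lt_min.
move=> /andP[ze zy]; rewrite in_itv/= => hz.
change (`|odd_slope t y - odd_slope t z| <= eps).
rewrite distrC odd_slope_same_side//; apply: he; first exact: norm1.
by apply: le_lt_trans ze; exact: ler_dist_dist.
Qed.

(** For arguments of opposite signs the bound passes through 0, where [t] vanishes: the two
    distances to 0 add up to [|y - z|], so [L] is preserved. *)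
Lemma lipschitz_odd_slope t L : t 0 = 0 ->
  (forall y z, 0 <= y <= 1 -> 0 <= z <= 1 -> `|t y - t z| <= L * `|y - z|) ->
  [lipschitz odd_slope t y | y in `[-1, 1]].
Proof.
move=> t0 tL; exists L; split; first exact: num_real.
move=> M LM [y z] [] /= yI zI; apply: (@le_trans _ _ (L * `|y - z|)); last first.
  by rewrite ler_wpM2r// ltW.
move: yI zI; rewrite !in_itv/= => /andP[y0 y1] /andP[z0 z1]; rewrite /odd_slope.
have [yp|yn] := leP 0 y; have [zp|zn] := leP 0 z.
- by rewrite opprK addrC distrC; apply: tL; apply/andP; split; lra.
- have := tL y 0; have := tL (- z) 0; rewrite t0 !subr0 lexx ler01 yp y1 => hz hy.
  have {}hy := hy isT isT; have {}hz : `|t (- z)| <= L * `|- z|.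
    by apply: hz => //; apply/andP; split; lra.
  apply: (le_trans (ler_normB _ _)); rewrite normrN; apply: (le_trans (lerD hy hz)).
  rewrite -mulrDr !ger0_norm; lra.
- have := tL (- y) 0; have := tL z 0; rewrite t0 !subr0 lexx ler01 zp z1 => hz hy.
  have {}hz := hz isT isT; have {}hy : `|t (- y)| <= L * `|- y|.
    by apply: hy => //; apply/andP; split; lra.
  rewrite opprK; apply: (le_trans (ler_normD _ _)); apply: (le_trans (lerD hy hz)).
  rewrite -mulrDr distrC !ger0_norm; lra.
- have -> : `|y - z| = `|- y - - z| by rewrite -opprD normrN.
  by apply: tL; apply/andP; split; lra.
Qed.

End Calculus.

(** * The three families of sequences *)

Section Cases.
Variables (R : realType) (alpha : nat -> R).
Hypothesis halpha : defining_sequence alpha.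
Implicit Types (n k : nat) (M : R).

Local Notation delta := (delta alpha).

(** The half turn [h] is the mean of [delta n] and [delta n.+1], so
    [sin h <= (M + 1) / 2 * delta n.+1]. All angles are at most pi/4, so [cos h] and the slope of
    the sine are at least [c]; the quotient gives [2 * c ^+ 2 / (M + 1)]. *)
Lemma radius_uniform_lower_bound M : 0 < M ->
  (forall n, (1 <= n)%N -> delta n <= M * delta n.+1) ->
  exists2 rho, 0 < rho & forall n, (1 <= n)%N -> rho <= arc_radius alpha n.
Proof.
move=> M0 hM; have pi0 := pi_gt0 R; pose c : R := cos (pi / 4).
have c0 : 0 < c by apply: cos_gt0_pihalf; apply/andP; split; lra.
exists (2 * c ^+ 2 / (M + 1)).
  by rewrite divr_gt0 ?mulr_gt0 ?exprn_gt0 ?addr_gt0.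
move=> n n1; rewrite /arc_radius /corner_radius; set h := corner_half _ _.
have hE : h = (delta n + delta n.+1) / 2.
  by rewrite /h /corner_half /beta /delta; field.
have d0 := delta_gt0 halpha n1; have d1 := delta_gt0 halpha (ltn0Sn n).
have e0 := delta_le_piquarter halpha n1.
have e1 := delta_le_piquarter halpha (ltn0Sn n).
have hn := hM n n1.
have h0 : 0 < h by rewrite hE; lra.
have hpi : h <= pi / 4 by rewrite hE; lra.
have sh0 : 0 < sin h by apply: sin_gt0_pihalf; apply/andP; split; lra.
have sh : sin h <= h by apply/sin_le_id/ltW.
have ch : c <= cos h by apply: ler_cos0pi; lra.
have sd : c * delta n.+1 <= sin (delta n.+1).
  by apply: sin_ge_linear; lra.
have hd : 2 * h <= (M + 1) * delta n.+1 by rewrite hE; lra.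
rewrite ler_pdivlMr// mulrAC ler_pdivrMr ?addr_gt0//.
have step1 : 2 * c ^+ 2 * sin h <= c ^+ 2 * ((M + 1) * delta n.+1).
  rewrite -(mulrC (c ^+ 2)) -mulrA ler_pM2l ?exprn_gt0//.
  by apply: le_trans hd; rewrite ler_pM2l.
apply: (le_trans step1); rewrite [leLHS](_ : _ = c * delta n.+1 * c * (M + 1)).
  rewrite ler_pM2r ?addr_gt0//; apply: ler_pM => //; last exact: ltW.
  by rewrite mulr_ge0 ?(ltW c0) ?(ltW d1).
by ring.
Qed.

(** The mean value bounds for s -> s^(-q), obtained from [1 + s <= expR s] and [ln s <= s - 1]. *)
Lemma powRN_sub_bounds (q a b : R) : 0 < q -> 0 < a -> a <= b ->
  q * b `^ (- q) * ((b - a) / b) <= a `^ (- q) - b `^ (- q)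
                                <= q * a `^ (- q) * ((b - a) / a).
Proof.
move=> q0 a0 ab; have b0 := lt_le_trans a0 ab.
have aE : a `^ (- q) = b `^ (- q) * expR (q * (ln b - ln a)).
  by rewrite /powR !gt_eqF// -expRD; congr expR; ring.
have bE : b `^ (- q) = a `^ (- q) * expR (- (q * (ln b - ln a))).
  by rewrite /powR !gt_eqF// -expRD; congr expR; ring.
have ln_le (x : R) : 0 < x -> ln x <= x - 1.
  move=> x0; have := @le_ln1Dx R (x - 1); rewrite (addrC 1) subrK; apply; lra.
have lnba : ln b - ln a <= (b - a) / a.
  rewrite -ln_div ?posrE// (le_trans (ln_le _ _)) ?divr_gt0//.
  by rewrite mulrBl divff ?gt_eqF.
have lnab : (b - a) / b <= ln b - ln a.
  rewrite -lerN2 opprB -ln_div ?posrE// (le_trans (ln_le _ _)) ?divr_gt0//.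
  by rewrite mulrBl divff ?gt_eqF// opprB.
apply/andP; split.
  have pb : 0 < b `^ (- q) by rewrite powR_gt0.
  rewrite aE; have := expR_ge1Dx (q * (ln b - ln a)).
  rewrite -(ler_pM2l pb) => h1; have pq := mulr_gt0 q0 pb.
  by move: lnab; rewrite -(ler_pM2l pq) => h2; lra.
have pa : 0 < a `^ (- q) by rewrite powR_gt0.
rewrite bE; have := expR_ge1Dx (- (q * (ln b - ln a))).
rewrite -(ler_pM2l pa) => h1; have pq := mulr_gt0 q0 pa.
by move: lnba; rewrite -(ler_pM2l pq) => h2; lra.
Qed.

Lemma caseA_delta : caseA alpha ->
  exists2 M, 0 < M & forall n, (1 <= n)%N -> delta n <= M * delta n.+1.
Proof.
move=> [C [q [C0 q0 alphaP]]]; pose m : R := 3 `^ (- q).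
have m0 : 0 < m by rewrite powR_gt0.
(* This is 3^(q+1): the ratio is at most ((n+2)/n)^(q+1), and n + 2 <= 3n. *)
exists (3 / m); first by rewrite divr_gt0.
move=> n n1; rewrite /delta !alphaP//.
have a0 : 0 < n%:R :> R by rewrite ltr0n.
have a1 : 1 <= n%:R :> R by rewrite ler1n.
have ab : n%:R <= n.+1%:R :> R by rewrite ler_nat.
have bc : n.+1%:R <= n.+2%:R :> R by rewrite ler_nat.
have b0 : 0 < n.+1%:R :> R by rewrite ltr0n.
have /andP[_ up] := powRN_sub_bounds q0 a0 ab.
have /andP[lo _] := powRN_sub_bounds q0 b0 bc.
have ba1 : n.+1%:R - n%:R = 1 :> R by rewrite -natr1; ring.
have cb1 : n.+2%:R - n.+1%:R = 1 :> R by rewrite -natr1; ring.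
move: up lo; rewrite ba1 cb1 !div1r.
set a : R := n%:R in a0 a1 ab *; have cE : n.+2%:R = a + 2 :> R.
  by rewrite -!natr1 /a; ring.
set an := a `^ _; set bn := n.+1%:R `^ _; set cn := n.+2%:R `^ _ => up lo.
have an0 : 0 < an by rewrite powR_gt0.
have c0 : 0 < n.+2%:R :> R by rewrite ltr0n.
have c3a : n.+2%:R <= 3 * a by rewrite cE; lra.
have cn_ge : m * an <= cn.
  rewrite -powRM ?(ltW a0)// /cn !powRN lef_pV2 ?posrE ?powR_gt0 ?mulr_gt0//.
  apply: ge0_ler_powR; rewrite ?nnegrE ?(ltW q0) ?(ltW c0)//.
  by rewrite mulr_ge0 ?(ltW a0).
have ci : (3 * a)^-1 <= n.+2%:R^-1 by rewrite lef_pV2 ?posrE ?mulr_gt0.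
have key : q * an * a^-1 <= 3 / m * (q * cn * n.+2%:R^-1).
  have -> : q * an * a^-1 = 3 / m * (q * (m * an) * (3 * a)^-1).
    by field; rewrite !lt0r_neq0.
  rewrite ler_pM2l ?divr_gt0// ler_pM// ?invr_ge0 ?mulr_ge0 ?(ltW q0) ?(ltW m0)
    ?(ltW an0) ?(ltW a0)//.
  by rewrite ler_pM2l.
have : an - bn <= 3 / m * (bn - cn).
  apply: (le_trans up); apply: (le_trans key).
  by rewrite ler_pM2l// divr_gt0.
by rewrite -(ler_pM2l C0) => h; lra.
Qed.

Lemma caseB_delta : caseB alpha ->
  exists2 M, 0 < M & forall n, (1 <= n)%N -> delta n <= M * delta n.+1.
Proof.
move=> [C [l [C0 /andP[l0 l1] alphaP]]]; exists l^-1; first by rewrite invr_gt0.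
move=> n n1; rewrite /delta !alphaP// !exprS le_eqVlt; apply/orP; left; apply/eqP.
by field; exact: lt0r_neq0.
Qed.

Lemma caseC_delta M : caseC alpha -> exists2 N, (1 <= N)%N &
  forall n, (N <= n)%N -> M * delta n.+1 < delta n.
Proof.
move=> [C [l [C0 /andP[l0 l1] alphaP]]].
pose M1 := `|M| + 2; have M10 : 0 < M1 by rewrite ltr_wpDl.
have lt1 : `|l| < 1 by rewrite gtr0_norm//; lra.
have /cvgrPdist_lt/(_ M1^-1) := cvg_expr lt1.
rewrite invr_gt0 => /(_ M10)[N _ hN]; exists N.+1 => // n Nn.
have n1 : (1 <= n)%N by exact: leq_ltn_trans Nn.
(* The exponent is (n+1)^2 - n^2, so [u] is the ratio [alpha n.+1 / alpha n], which tends to 0. It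
   suffices that [(|M| + 1) * u < 1]. *)
pose u := l ^+ (n.*2.+1).
have u0 : 0 < u by rewrite exprn_gt0.
have uM : u < M1^-1.
  have := hN n.*2.+1; rewrite sub0r normrN gtr0_norm//; apply.
  rewrite /=; have := ltnW Nn; lia.
have aS : alpha n.+1 = alpha n * u.
  rewrite !alphaP// /u -mulrA -exprD; congr (_ * l ^+ _); lia.
have a0 := alpha_gt0 halpha n1; have a2 := alpha_gt0 halpha (ltn0Sn n.+1).
have uM1 : M1 * u < 1 by rewrite mulrC -ltr_pdivlMr// mul1r.
have d0 := delta_gt0 halpha (ltn0Sn n).
apply: (@le_lt_trans _ _ (`|M| * delta n.+1)); first by rewrite ler_pM2r// ler_norm.
have : `|M| * delta n.+1 <= `|M| * (alpha n.+1 / 2).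
  by rewrite ler_wpM2l// /delta; lra.
move=> /le_lt_trans; apply; rewrite /delta aS.
have : alpha n * (M1 * u) < alpha n * 1 by rewrite ltr_pM2l.
have : 0 < alpha n * u by rewrite mulr_gt0.
rewrite /M1; lra.
Qed.

End Cases.
Unset Implicit Arguments.

Theorem theorem1p4 (R : realType) (alpha : nat -> R) (x : R -> R)
    (halpha : defining_sequence alpha)
    (hx : [set ((x y, y) : plane R) | y in `[-1, 1]] =
          boundary (bodyK alpha) `&` [set p : plane R | 0 <= p.1]) :
  exists dx : R -> R,
    [/\ is_derivative_on `[-1, 1] x dx,
        {within `[-1, 1], continuous dx},
        caseA alpha \/ caseB alpha -> [lipschitz dx y | y in `[-1, 1]] &
        caseC alpha ->
          forall U : set R, nbhs 0 U ->
            ~ [lipschitz dx y | y in U `&` `[-1, 1]]].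
Proof.
have [t ht] := slope_exists halpha; have t0 := slope0 ht.
have dc : {within `[-1, 1], continuous (odd_slope t)}.
  exact: odd_slope_continuous t0 (slope_continuous halpha ht).
exists (odd_slope t); split=> //.
- apply: supergradient_derivative => // y z /=; rewrite !in_itv/= => hy hz.
  have [y0|y0|->] := ltgtP y 0.
  + have [|n [phi [n1 yphi ty]]] := ht.2 (- y).
      by have /andP[? ?] := hy; apply/andP; split; lra.
    have [_] := on_piece_supergradient halpha hx n1 yphi hz.
    by rewrite /odd_slope (lt_geF y0) /= ty opprK.
  + have [|n [phi [n1 yphi ty]]] := ht.2 y.
      by have /andP[? ?] := hy; apply/andP; split; lra.
    have [+ _] := on_piece_supergradient halpha hx n1 yphi hz.
    by rewrite /odd_slope (ltW y0) ty mulNr.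
  + rewrite /odd_slope lexx t0 oppr0 mul0r addr0.
    exact (equator_supergradient halpha hx hz).
- move=> AB.
  have [M M0 hM] : exists2 M, 0 < M &
      forall n, (1 <= n)%N -> delta alpha n <= M * delta alpha n.+1.
    by case: AB => [/caseA_delta|/caseB_delta].
  have [rho rho0 hrho] := radius_uniform_lower_bound halpha M0 hM.
  apply: lipschitz_odd_slope => // y z; exact: (slope_lipschitz halpha ht rho0 hrho).
- move=> C U /nbhs_ballP[e /= e0 eU] [M0 [_ hM]].
  pose M := `|M0| + 1.
  have {}hM : forall y z, (U `&` `[-1, 1]) y -> (U `&` `[-1, 1]) z ->
      `|odd_slope t y - odd_slope t z| <= M * `|y - z|.
    move=> y z yU zU; apply: (hM M _ (y, z)) => //.
    by rewrite /M (le_lt_trans (ler_norm _))// ltrDl.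
  (* Between the ends of the arc the slope changes by at least [delta n + delta n.+1], while the
     height changes by at most [2 * delta n.+1]; the factor [2 * M] makes these contradict the
     Lipschitz bound. *)
  have [N N1 hN] := caseC_delta halpha (2 * M) C.
  have e1 : 0 < Num.min e 1 by rewrite lt_min e0 ltr01.
  have [n0 n01 hn0] := alpha_lt_eps halpha e1.
  pose n := maxn N n0.
  have n1 : (1 <= n)%N by rewrite (leq_trans N1)// leq_maxl.
  have an : alpha n < Num.min e 1.
    by apply: le_lt_trans hn0; apply: alpha_le => //; exact: leq_maxr.
  have /andP[S0 Sa] := ptS_snd_itv halpha n1.
  have T0 := ptT_snd_gt0 halpha (ltn0Sn n).
  have TS := on_piece_bounds halpha n1 (on_piece_ptS halpha n1).
  have {TS} /andP[TS _] := TS.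
  have inU w : 0 < w -> w <= alpha n -> (U `&` `[-1, 1]) w.
    move=> w0 wa; have := le_lt_trans wa an; rewrite lt_min => /andP[we w1].
    split; last by rewrite /= in_itv/=; apply/andP; split; lra.
    by apply: eU; rewrite /ball/= sub0r normrN gtr0_norm.
  have /inU SU : 0 < (ptS alpha n.+1).2 by [].
  have := hM _ _ (SU Sa) (inU _ T0 (le_trans TS Sa)).
  have [S1 T1] : (ptS alpha n.+1).2 <= 1 /\ (ptT alpha n.+1).2 <= 1.
    by have := an; rewrite lt_min => /andP[_ ?]; split; lra.
  rewrite /odd_slope (ltW S0) (ltW T0).
  rewrite (slope_piece halpha ht n1 S1 (on_piece_ptS halpha n1)).
  rewrite (slope_piece halpha ht n1 T1 (on_piece_ptT halpha n1)).
  have bb := ltW (beta_lt halpha n1).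
  have := tan_expanding (ltW (beta_gt0 halpha (ltn0Sn n))) bb
    (beta_lt_pihalf halpha n1).
  (* Both ends are at distance [sin (delta n.+1)] from A_(n+1), which bounds each vertical
     displacement. *)
  have gap : (ptS alpha n.+1).2 - (ptT alpha n.+1).2 <= 2 * delta alpha n.+1.
    have s0 := sin_delta_gt0 halpha (ltn0Sn n).
    have := sin_le_id (ltW (delta_gt0 halpha (ltn0Sn n))).
    rewrite (ptS_line halpha n1) ptT_corner /= /GRing.scale /=.
    have := cos_le1 (beta alpha n); have := cos_le1 (beta alpha n.+1).
    nra.
  rewrite (@ger0_norm _ (_.2 - _)) ?subr_ge0// => tanb lip.
  have M0' : 0 < M by rewrite /M ltr_wpDl.
  have := hN n (leq_maxl _ _); rewrite ltNge => /negP; apply.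
  have dd := delta_gt0 halpha (ltn0Sn n).
  have bE : beta alpha n - beta alpha n.+1 = delta alpha n + delta alpha n.+1.
    by rewrite /beta /delta; field.
  have : M * ((ptS alpha n.+1).2 - (ptT alpha n.+1).2) <= M * (2 * delta alpha n.+1).
    by rewrite ler_pM2l.
  have : tan (beta alpha n) - tan (beta alpha n.+1) <=
     `|- tan (beta alpha n) - - tan (beta alpha n.+1)|.
    by rewrite -opprD normrN ler_norm.
  lra.
Qed.
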